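(* There is a fibered golden polyhedron exchange map $\widehat\Psi:\widehat\Sigma\to\widehat\Sigma$ on the flat $3$-torus $\widehat\Sigma=(\mathbb{R}/2\mathbb{Z})^3$ such that the map $\Theta:\Sigma\to\widehat\Sigma$ given by $$\Theta(x,y)=\Big(1,\tfrac12,0\Big)+\Big(\frac{x}{\phi},\frac{x-y}{2},y\Big)\quad\text{(coordinates taken mod }2\mathbb{Z})$$ is an injective embedding which is a semi-conjugacy between $\Psi$ and $\widehat\Psi$; that is, $\widehat\Psi\circ\Theta=\Theta\circ\Psi$ wherever all maps are defined.
   Context: Let $\phi=(1+\sqrt5)/2$ and $\mathbb{Z}[\phi]=\{m+n\phi: m,n\in\mathbb{Z}\}$. The Penrose kite $K$ is the convex (solid) quadrilateral with vertices $(-1,0),(0,1),(0,-1),(\phi^{-3},0)$. The outer billiards map on $\mathbb{R}^2-K$ sends $x_0$ to the point $x_1$ such that the segment $\overline{x_0x_1}$ is tangent to $K$ at its midpoint and $K$ lies to the right of the ray from $x_0$ through $x_1$ ($x_1=2v-x_0$ with $v$ a vertex of $K$; undefined when $v$ is not unique). Let $\psi$ be the square of the outer billiards map. Return map $\Psi$: Let $\Sigma=\mathbb{R}\times(-2,2]$. Let $B$ be the set of points of $\Sigma$ in the two triangles with vertices $(0,1),(-\phi^{-3},2),(1,2)$ and $(0,-1),(-\phi^{-3},-2),(1,-2)$ (bounded by extensions of the sides of $K$). Let $\Sigma_-$ and $\Sigma_+$ be the two components (left and right) of $\Sigma-K-B$. Let $\Psi_\pm:\Sigma_\pm\to\Sigma_\pm$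 be the first return map of $\psi$ to $\Sigma_\pm$. Then $\Psi:\Sigma\to\Sigma$ is $\Psi_+$ on $\Sigma_+$, $\Psi_-$ on $\Sigma_-$, and the identity on $K\cup B$. Polyhedron exchange maps: a polytope exchange map on a compact flat manifold $M$ consists of two finite partitions $X_1,X_2$ of $M$ into convex polytopes (meeting only along boundaries) and a piecewise isometric bijection $f$ which, on (the interior of) each polytope $P$ of $X_1$, is a translation with $f(P)$ a polytope of $X_2$; technically $f$ is not defined on the boundaries of the polytopes of $X_1$. For $M=\mathbb{R}^n/\Lambda$ with $\Lambda\subset\mathbb{Z}^n$ a discrete group of translations, a polytope in $M$ is golden if any lift to $\mathbb{R}^n$ has all vertices with coordinates in $\mathbb{Z}[\phi]$; the exchange map is golden if all the polytopes are golden and all translations are by vectors in $\mathbb{Z}[\phi]^n$. A golden polyhedron exchange map on $\widehat\Sigma$ is fibered if it preserves each horizontal $2$-torus (third coordinate constant) and its restriction to each horizontal $2$-torus whose height lies in $\mathbb{Z}[\phi]$ is a golden polygon exchange map. *)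

(* Defs.v *)
From HB Require Import structures.
From mathcomp Require Import all_boot all_order all_algebra.
From mathcomp Require Import all_classical all_reals all_analysis.

Set Implicit Arguments.
Unset Strict Implicit.
Unset Printing Implicit Defensive.

Import Order.TTheory GRing.Theory Num.Theory.
Import numFieldNormedType.Exports.

Local Open Scope classical_set_scope.
Local Open Scope ring_scope.
Local Open Scope quotient_scope.

Definition phi (R : realType) : R := (1 + Num.sqrt 5) / 2.

Definition Zphi (R : realType) : set R :=
  [set x | exists m n : int, x = m%:~R + n%:~R * phi R].

Definition golden_vector (R : realType) n (v : 'rV[R]_n) : Prop :=
  forall j, Zphi (v 0 j).

Definition hull (R : realType) (V : lmodType R) (s : seq V) : set V :=
  [set v | exists a : 'I_(size s) -> R,
    [/\ forall i, 0 <= a i, \sum_i a i = 1 & v = \sum_i a i *: s`_i]].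

(* The vertices of a convex polytope, given only as a set. *)
Definition extreme_point (R : realType) (V : lmodType R) (Q : set V) (v : V)
    : Prop :=
  Q v /\ forall a b, Q a -> Q b -> v = 2^-1 *: (a + b) -> a = b.

Section OuterBilliards.
Variable R : realType.
Implicit Types p q v w : R * R.

Definition kite_vertices : seq (R * R) :=
  [:: (-1, 0); (0, 1); (0, -1); ((phi R) ^- 3, 0)].

Definition kite : set (R * R) := hull kite_vertices.

Definition cross v w : R := v.1 * w.2 - v.2 * w.1.

(* K lies (weakly) to the right of the ray that starts at p and passes
   through v. *)
Definition kite_on_right p v : bool :=
  `[< forall w, kite w -> cross (v - p) (w - p) <= 0 >].

Definition outer_billiards p : option (R * R) :=
  if `[< kite p >] then None
  else if [seq v <- kite_vertices | kite_on_right p v] is [:: v]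
       then Some (v + v - p) else None.

Definition psi p : option (R * R) :=
  obind outer_billiards (outer_billiards p).

(* The graph of the first return map to A of the partially defined map g. *)
Definition first_return (T : Type) (g : T -> option T) (A : set T) (p q : T)
    : Prop :=
  [/\ A p, A q &
      exists n, [/\ (0 < n)%N, iter n (obind g) (Some p) = Some q &
        forall m z, (0 < m < n)%N -> iter m (obind g) (Some p) = Some z ->
          ~ A z]].

Definition Sigma : set (R * R) := [set p | - 2 < p.2 <= 2].

Definition B : set (R * R) :=
  Sigma `&` (hull [:: (0, 1); (- (phi R) ^- 3, 2); (1, 2)] `|`
             hull [:: (0, -1); (- (phi R) ^- 3, -2); (1, -2)]).

(* (-2,0) and (1,0) lie to the left and to the right of K. *)
Definition Sigma_left : set (R * R) :=
  connected_component (Sigma `\` kite `\` B) (-2, 0).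
Definition Sigma_right : set (R * R) :=
  connected_component (Sigma `\` kite `\` B) (1, 0).

(* The graph of the return map, which is a partially defined map. *)
Definition Psi p q : Prop :=
  [\/ (kite `|` B) p /\ q = p,
      first_return psi Sigma_left p q |
      first_return psi Sigma_right p q].

End OuterBilliards.

Section Torus.
Variables (R : realType) (n : nat).

Definition even_lattice : {pred 'rV[R]_n} :=
  [pred v : 'rV[R]_n | [forall j, v 0 j / 2 \is a Num.int]].

Fact even_lattice_zmod_closed : zmod_closed even_lattice.
Proof.
split=> [|u v /forallP uL /forallP vL]; apply/forallP => j.
  by rewrite mxE mul0r rpred0.
by rewrite !mxE mulrBl rpredB.
Qed.

HB.instance Definition _ :=
  GRing.isZmodClosed.Build 'rV[R]_n even_lattice even_lattice_zmod_closed.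

(* The flat torus (R/2Z)^n with the quotient topology. *)
Definition torus := quotient_topology (Quotient.quot even_lattice).


End Torus.

Section PolytopeExchange.
Variables (R : realType) (n : nat).
Local Notation V := ('rV[R]_n).
Local Notation T := (torus R n).

(* A convex polytope of the torus is represented by one of its lifts Q, a
   solid convex polytope of R^n whose interior embeds in the torus.  Distinct
   lifts differ by vectors of 2Z^n. *)
Definition lifted_polytope (Q : set V) : Prop :=
  [/\ exists s : seq V, Q = hull s, Q° !=set0 &
      set_inj Q° (\pi_T : V -> T)].

Definition pieces_interior N (X : 'I_N -> set V) : set T :=
  \bigcup_i ((\pi_T : V -> T) @` (X i)°).

Definition torus_partition N (X : 'I_N -> set V) : Prop :=
  [/\ forall i, lifted_polytope (X i),
      \bigcup_i ((\pi_T : V -> T) @` X i) = setT &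
      trivIset setT (fun i => (\pi_T : V -> T) @` (X i)°)].

(* The exchange map is only meaningful on the interiors of the pieces of the
   first partition; its values elsewhere are irrelevant.  The translation
   vectors are determined modulo 2Z^n, and are chosen compatibly with the
   lifts of the pieces. *)
Record polytope_exchange := PolytopeExchange {
  source_card : nat;
  source : 'I_source_card -> set V;
  target_card : nat;
  target : 'I_target_card -> set V;
  shift : 'I_source_card -> V;
  exchange_map :> T -> T;
  source_partition : torus_partition source;
  target_partition : torus_partition target;
  exchange_bij : set_bij (pieces_interior source) (pieces_interior target)
                         exchange_map;
  exchange_shift : forall i x, (source i)° x ->
    exchange_map (\pi_T x) = \pi_T (x + shift i);
  exchange_piece : forall i, exists j,
    target j = [set x + shift i | x in source i]
}.

Definition exchange_domain (E : polytope_exchange) : set T :=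
  pieces_interior (@source E).

Definition golden_polytope (Q : set V) : Prop :=
  forall v, extreme_point Q v -> golden_vector v.

Definition golden (E : polytope_exchange) : Prop :=
  [/\ forall i, golden_polytope (@source E i),
      forall j, golden_polytope (@target E j) &
      forall i, golden_vector (@shift E i)].

End PolytopeExchange.

Section Fibered.
Variable R : realType.

Definition at_height (h : R) (v : 'rV[R]_2) : 'rV[R]_3 :=
  row_mx v (const_mx h : 'rV[R]_1).

Definition horizontal_torus (h : R) : set (torus R 3) :=
  [set \pi_(torus R 3) (at_height h v) | v in setT].

Definition horizontal_part (t : 'rV[R]_3) : 'rV[R]_2 :=
  lsubmx (t : 'rV[R]_(2 + 1)).

(* F is a restriction of E to the horizontal torus of height h, identified
   with (R/2Z)^2 by the first two coordinates: every polygon of F is the slice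
   of a closed polyhedron of E, translated as this polyhedron is.  Taking closed
   polyhedra covers the heights at which E has horizontal faces; there the map
   is extended to the horizontal torus from one of the sides. *)
Definition restricts_to (E : polytope_exchange R 3) (h : R)
    (F : polytope_exchange R 2) : Prop :=
  forall k, exists i (c : int),
    source k = [set v | @source _ _ E i (at_height (h + 2 * c%:~R) v)] /\
    @shift _ _ F k = horizontal_part (@shift _ _ E i).

Definition fibered_golden (E : polytope_exchange R 3) : Prop :=
  [/\ golden E,
      forall h, E @` (horizontal_torus h `&` exchange_domain E)
                  `<=` horizontal_torus h &
      forall h, Zphi h -> exists F : polytope_exchange R 2,
        golden F /\ restricts_to E h F].

End Fibered.

Definition Theta_lift (R : realType) (p : R * R) : 'rV[R]_3 :=
  \row_j [:: 1 + p.1 / phi R; 2^-1 + (p.1 - p.2) / 2; p.2]`_j.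

Definition Theta (R : realType) (p : R * R) : torus R 3 :=
  \pi_(torus R 3) (Theta_lift p).

(* An injective map of A which is locally a homeomorphism onto its image.  This
   is the sense in which a line winding densely in a torus is embedded: it is
   not a homeomorphism onto its image for the induced topology. *)
Definition injective_embedding (S U : topologicalType) (A : set S)
    (f : S -> U) : Prop :=
  [/\ set_inj A f, {within A, continuous f} &
      forall p, A p -> exists2 N, nbhs p N &
        forall q, (A `&` N) q -> forall W, nbhs q W ->
          exists2 W', nbhs (f q) W' & A `&` N `&` f @^-1` W' `<=` W].

(* Main.v *)
From HB Require Import structures.
From Stdlib Require Import ZArith.
Require Import Defs.
From mathcomp Require Import all_boot all_order all_algebra.
From mathcomp Require Import all_classical all_reals all_analysis.
From mathcomp Require Import ring lra zify ssrZ.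
Import numFieldNormedType.Exports.

(** Let V_0, V_1, V_2, V_3 be the vectors (0,4), (-2,2), (-4/phi,0), (-2,-2):
twice the differences w - v of vertices of the kite that lie on two parallel
supporting lines, in the order in which they occur when these lines turn.
Away from the kite, psi is the translation by one of the vectors V_i or -V_i on
each of eight sectors.  The i-th sector is left by entering a strip S_i, which
is bounded by the line of an edge and by its mirror image in the opposite
vertex, and which is a fundamental domain for the translations by V_i.  Half a
turn of psi around the kite thus is a composition H of four maps, the i-th of
which slides a point along V_i into S_i, and the return map is H o H, up to
multiples of V_0, which Theta does not see.  This holds up to the boundary of
the kite, even though two further small regions come into play there: the
transitions of an orbit between the regions on which psi is a translation are
finite in number, and each is settled by linear inequalities with coefficients
in Z[phi] (half_turn, Psi_on_course).  On the kite and on the set B, and up to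
multiples of V_0 again, H is the identity.

The linear part of Theta maps the plane into R^3, and V_i to a vector u_i.  The
affine function defining S_i extends to a linear form f_i on R^3 with
f_i(u_i) = -2, so that S_i becomes a slab of width 2 and sliding makes sense
in R^3.  The eight forms are chosen such that sliding along u_i induces
a bijection from a torus R^3/L_i to the next one R^3/L_(i+1), where L_0 and L_8
both are (2Z)^3 (section StripChain).  The composition of the eight slides is
therefore a bijection of the torus, and Theta conjugates the return map to it.

The points of a fundamental box with the same itinerary, that is with the same
eight numbers of steps, form a convex polytope on which this bijection is
a translation.  Half-open versions of these polytopes tile the torus, and since
the map is bijective so do their images (exchange_of_bijection): no
volume has to be computed.  All maximal minors of the matrix of the
forms f_i and of the coordinate forms are zero or units of Z[phi], so that the
vertices of all the cells are golden (golden_slabs).  The slides change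
the third coordinate by even integers, and the same two arguments apply in
dimension 2 to the slices of the cells at a golden height (exchange2). *)

Set Implicit Arguments.
Unset Strict Implicit.
Unset Printing Implicit Defensive.

Import Order.TTheory GRing.Theory Num.Theory.

(* The key Z already delimits the scope of the type int. *)
Delimit Scope Z_scope with Zc.
Local Arguments Z.mul : simpl never.
Local Arguments Z.add : simpl never.
Local Arguments Z.opp : simpl never.

Local Open Scope classical_set_scope.
Local Open Scope ring_scope.
Local Open Scope quotient_scope.

(** * The torus as a quotient of the space *)

Lemma int_near0 (R : realDomainType) (m : int) :
  -1 < m%:~R :> R -> m%:~R < 1 :> R -> m = 0.
Proof.
by rewrite (ltr_int R m 1) -(rmorphN1 (intr : int -> R)) ltr_int; lia.
Qed.

Section TorusBasics.
Variables (R : realType) (n : nat).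
Implicit Types u v : 'rV[R]_n.

Lemma even_latticeP v :
  reflect (forall j, exists m : int, v 0 j = 2 * m%:~R) (v \in @even_lattice R n).
Proof.
apply: (iffP forallP) => [H j|H j].
  have /intrP[m Hm] := H j; exists m.
  by rewrite -Hm mulrC divfK // pnatr_eq0.
have [m ->] := H j; rewrite mulrC mulKf ?pnatr_eq0 //; exact: intr_int.
Qed.

Lemma torus_piE u v :
  (\pi_(torus R n) u = \pi_(torus R n) v) <-> (u - v \in @even_lattice R n).
Proof.
have := Quotient.idealrBE (@even_lattice R n) u v => ->.
by split=> [->|/eqP].
Qed.

Lemma torus_piD u v : v \in @even_lattice R n ->
  \pi_(torus R n) (u + v) = \pi_(torus R n) u.
Proof. by move=> vL; apply/torus_piE; rewrite addrC addKr. Qed.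

Lemma torus_pi_continuous : continuous (\pi_(torus R n) : 'rV[R]_n -> torus R n).
Proof. exact: pi_continuous. Qed.

Lemma torus_repr (t : torus R n) : exists v, t = \pi_(torus R n) v.
Proof. by exists (repr t); rewrite reprK. Qed.

Lemma rV_nbhsP (v : 'rV[R]_n) (A : set 'rV[R]_n) :
  nbhs v A <->
  exists2 e : R, 0 < e & forall w : 'rV[R]_n, (forall j, `|w 0 j - v 0 j| < e) -> A w.
Proof.
split.
  move=> /nbhs_ballP[e /= e0 He]; exists e => // w wv; apply: He; split => // i j.
  by rewrite !ord1 /ball /= distrC; exact: wv.
move=> [e e0 He]; apply/nbhs_ballP; exists e => //= w [_ wv]; apply: He => j.
by have := wv 0 j; rewrite /ball /= distrC.
Qed.

Lemma torus_pi_open (A : set 'rV[R]_n) : open A ->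
  open ((\pi_(torus R n) : 'rV[R]_n -> torus R n) @` A).
Proof.
move=> oA; rewrite /open /= /quotient_open.
rewrite openE => v [w Aw] /torus_piE wv.
move: oA; rewrite openE => /(_ w Aw) /rV_nbhsP[e e0 He].
apply/rV_nbhsP; exists e => // u uv.
exists (u + (w - v)); last exact: torus_piD.
by apply: He => j; rewrite !mxE; have -> : u 0 j + (w 0 j - v 0 j) - w 0 j = u 0 j - v 0 j by ring.
Qed.

End TorusBasics.

(** * Convex hulls of finite sets *)

Section Hulls.
Variables (R : realType) (V : lmodType R).
Implicit Types (s : seq V) (v : V) (Q : set V) (f : {scalar V}).

(** A convex combination indexed by any finite type, with values in s, is turned
into one indexed by the positions in s by adding up the weights of equal points. *)
Lemma hull_sum s (I : finType) (P : pred I) (a : I -> R) (p : I -> V) :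
  (forall i, P i -> 0 <= a i) -> (forall i, P i -> p i \in s) ->
  \sum_(i | P i) a i = 1 -> hull s (\sum_(i | P i) a i *: p i).
Proof.
move=> a0 ps a1.
pose b (j : 'I_(size s)) := \sum_(i | P i && (index (p i) s == j)) a i.
have part (W : nmodType) (F : I -> W) : \sum_(i | P i) F i =
    \sum_(j < size s) \sum_(i | P i && (index (p i) s == j)) F i.
  have [s0|s0] := posnP (size s).
    rewrite [RHS]big1 => [|j]; last by have := ltn_ord j; rewrite [X in (_ < X)%N]s0.
    by rewrite big1 // => i /ps; rewrite (size0nil s0).
  rewrite (partition_big (fun i => insubd (Ordinal s0) (index (p i) s)) xpredT) //=.
  apply: eq_bigr => j _; apply: eq_bigl => i.
  case Pi: (P i) => //=; rewrite -(inj_eq val_inj) val_insubd index_mem.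
  by rewrite (ps _ Pi).
exists b; split.
- by move=> j; apply: sumr_ge0 => i /andP[/a0].
- by rewrite -a1 part.
- rewrite part; apply: eq_bigr => j _; rewrite scaler_suml; apply: eq_bigr => i.
  by move=> /andP[Pi /eqP <-]; rewrite nth_index // ps.
Qed.

Lemma mem_hull s v : v \in s -> hull s v.
Proof.
move=> vs; have := @hull_sum s unit xpredT (fun=> 1) (fun=> v).
by rewrite !big_const card_unit /= !addr0 scale1r; apply.
Qed.

Lemma hull_trans s t : (forall x, x \in t -> hull s x) -> hull t `<=` hull s.
Proof.
move=> ts v [a [a0 a1 ->]].
have /choice[b Hb] : forall i : 'I_(size t), exists b : 'I_(size s) -> R,
    [/\ forall j, 0 <= b j, \sum_j b j = 1 & t`_i = \sum_j b j *: s`_j].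
  by move=> i; apply: ts; rewrite mem_nth.
under eq_bigr => i _.
  have [_ _ ->] := Hb i; rewrite scaler_sumr.
  under eq_bigr do rewrite scalerA.
  over.
rewrite exchange_big /=.
under eq_bigr do rewrite -scaler_suml.
apply: hull_sum => [j _|j _|]; last 1 first.
- rewrite exchange_big /= -a1; apply: eq_bigr => i _.
  by have [_ b1 _] := Hb i; rewrite -mulr_sumr b1 mulr1.
- by apply: sumr_ge0 => i _; have [b0 _ _] := Hb i; rewrite mulr_ge0.
- by rewrite mem_nth.
Qed.

Lemma hull_segment s (x y : V) (l m : R) : x \in s -> y \in s ->
  0 <= l -> 0 <= m -> l + m = 1 -> hull s (l *: x + m *: y).
Proof.
move=> xs ys l0 m0 lm.
have := @hull_sum s bool xpredT (fun b => if b then l else m) (fun b => if b then x else y).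
by rewrite !big_bool; apply=> // -[].
Qed.

Lemma hull_ge s f (c : R) v : (forall x, x \in s -> c <= f x) -> hull s v -> c <= f v.
Proof.
move=> sc [a [a0 a1 ->]].
rewrite -[c]mul1r -a1 mulr_suml raddf_sum; apply: ler_sum => i _ /=.
by rewrite linearZ /= ler_wpM2l // sc // mem_nth.
Qed.

Definition is_polytope Q := exists s, Q = hull s.

(** For f x < c <= f y, the point of the segment from x to y at the level c. *)
Definition crossing f (c : R) (x y : V) : V :=
  (f y - f x)^-1 *: ((c - f x) *: y + (f y - c) *: x).

(** The part of a weight lying strictly below the level is paired with the
part above it, in proportion to the height above the level: each pair is then
traded for the point where the segment joining the two meets the level. *)
Lemma hull_halfspace s f (c : R) :
  hull s `&` [set v | c <= f v] =
  hull ([seq x <- s | c <= f x] ++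
        [seq crossing f c p.1 p.2 |
           p <- [seq (x, y) | x <- s, y <- s] & f p.1 < c <= f p.2]).
Proof.
apply/seteqP; split => [v [[a [a0 a1 Ev]] /= cv]|v].
  set t := _ ++ _.
  pose g (i : 'I_(size s)) := f s`_i - c.
  pose N (i : 'I_(size s)) := g i < 0.
  have Eg : \sum_i a i * g i = f v - c.
    rewrite Ev raddf_sum -[in RHS](mul1r c) -a1 mulr_suml -sumrB.
    by apply: eq_bigr => i _; rewrite /g mulrBr; congr (_ - _); rewrite /= linearZ.
  pose A := \sum_(i | ~~ N i) a i * g i.
  pose D := \sum_(i | N i) a i * - g i.
  have D0 : 0 <= D.
    by apply: sumr_ge0 => i Ni; rewrite mulr_ge0 // oppr_ge0 ltW.
  have AD : A - D = f v - c.
    rewrite -Eg (bigID N) /= addrC /A /D; congr (_ + _).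
    by rewrite -sumrN; apply: eq_bigr => i _; rewrite mulrN opprK.
  have DA : D <= A by rewrite -subr_ge0 AD subr_ge0.
  have st i : ~~ N i -> s`_i \in t.
    move=> Ni; have : ~~ (f s`_i - c < 0) := Ni.
    by rewrite -leNgt subr_ge0 => ci; rewrite mem_cat mem_filter ci mem_nth.
  have xt i j : N i -> ~~ N j -> crossing f c s`_i s`_j \in t.
    move=> Ni Nj; have : f s`_i - c < 0 := Ni; have : ~~ (f s`_j - c < 0) := Nj.
    rewrite -leNgt subr_ge0 subr_lt0 => cj ci; rewrite mem_cat; apply/orP; right.
    apply/mapP; exists (s`_i, s`_j) => //; rewrite mem_filter /= ci cj /=.
    by apply/allpairsP; exists (s`_i, s`_j); rewrite !mem_nth.
  have [A0|A0] := eqVneq A 0.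
    have {D0 DA}D0 : D = 0 by apply/eqP; rewrite eq_le D0 -{1}A0 DA.
    have aN i : N i -> a i = 0.
      move=> Ni; have /psumr_eq0P H : forall i, N i -> 0 <= a i * - g i.
        by move=> k Nk; rewrite mulr_ge0 // oppr_ge0 ltW.
      have /eqP := H D0 i Ni.
      by rewrite mulf_eq0 oppr_eq0 (lt_eqF (Ni : g i < 0)) orbF => /eqP.
    have -> : v = \sum_(i | ~~ N i) a i *: s`_i.
      by rewrite Ev (bigID N) /= big1 ?add0r // => i /aN ->; rewrite scale0r.
    apply: hull_sum => //.
    by rewrite -a1 [in RHS](bigID N) /= [in RHS]big1 ?add0r // => i /aN.
  have Ap : 0 < A by rewrite lt_neqAle eq_sym A0 (le_trans D0 DA).
  pose I := ('I_(size s) + 'I_(size s) * 'I_(size s))%type.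
  pose P (k : I) := match k with inl i => ~~ N i | inr (i, j) => N i && ~~ N j end.
  pose w (k : I) := match k with
    | inl i => a i * (1 - D / A)
    | inr (i, j) => a i * a j * (g j - g i) / A end.
  pose p (k : I) := match k with
    | inl i => s`_i | inr (i, j) => crossing f c s`_i s`_j end.
  have bigI (W : nmodType) (F : I -> W) : \sum_(k | P k) F k =
      \sum_(i | ~~ N i) F (inl i) + \sum_(i | N i) \sum_(j | ~~ N j) F (inr (i, j)).
    by rewrite big_sumType /= pair_big_dep /=; congr (_ + _); apply: eq_big => [[]|[]].
  have -> : v = \sum_(k | P k) w k *: p k.
    rewrite bigI /= Ev (bigID N) /= addrC.
    transitivity (\sum_(i | ~~ N i) (a i * (1 - D / A)) *: s`_i +
       (\sum_(i | N i) \sum_(j | ~~ N j) ((a i * (a j * g j) / A) *: s`_i +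
                                     (a j * (a i * - g i) / A) *: s`_j))).
      under [X in _ = _ + X]eq_bigr do rewrite big_split.
      rewrite big_split /= [X in _ + (_ + X)]exchange_big /= addrCA.
      rewrite -big_split /= addrC; congr (_ + _).
        apply: eq_bigr => i _; rewrite -scaler_suml; congr (_ *: _).
        by rewrite -mulr_suml -mulr_sumr -/A mulfK.
      apply: eq_bigr => i _; rewrite -scaler_suml -scalerDl; congr (_ *: _).
      by rewrite -mulr_suml -mulr_sumr -/D; field.
    congr (_ + _); apply: eq_bigr => i Ni; apply: eq_bigr => j Nj.
    have gij : g j - g i != 0.
      by rewrite subr_eq0; apply: contraTneq Ni => eij; rewrite -[N i]/(g i < 0) -eij.
    have -> : crossing f c s`_i s`_j = (g j - g i)^-1 *: ((- g i) *: s`_j + g j *: s`_i).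
      rewrite /crossing /g; congr (_^-1 *: (_ *: _ + _)); last by rewrite opprB.
      by rewrite opprB addrA subrK.
    rewrite scalerDr scalerDr !scalerA addrC.
    by congr (_ *: _ + _ *: _); field; rewrite A0 gij.
  apply: hull_sum.
  - case=> [i|[i j]] /=; first by move=> _; rewrite mulr_ge0 // subr_ge0 ler_pdivrMr ?mul1r.
    move=> /andP[Ni Nj]; rewrite !mulr_ge0 ?invr_ge0 ?(ltW Ap) // subr_ge0.
    by rewrite (le_trans (ltW Ni)) // leNgt.
  - by case=> [i /st|[i j] /andP[Ni /(xt _ _ Ni)]].
  - rewrite bigI /= -[RHS]a1 [RHS](bigID N) /= [RHS]addrC.
    transitivity (\sum_(i | ~~ N i) (a i * (1 - D / A)) +
       (\sum_(i | N i) \sum_(j | ~~ N j) ((a i * (a j * g j) / A)  +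
                                     (a j * (a i * - g i) / A) ))).
      by congr (_ + _); apply: eq_bigr => i Ni //; apply: eq_bigr => j Nj; rewrite /w; ring.
    under [X in _ + X = _]eq_bigr do rewrite big_split.
    rewrite big_split /= [X in _ + (_ + X)]exchange_big /= addrCA.
    rewrite -big_split /= addrC; congr (_ + _).
      apply: eq_bigr => i _; rewrite -mulr_suml -mulr_sumr -/D; field.
      exact: A0.
    by apply: eq_bigr => i _; rewrite -mulr_suml -mulr_sumr -/A mulfK.
move=> vt; split; last first.
  apply: hull_ge vt => x; rewrite mem_cat mem_filter => /orP[/andP[]//|].
  case/mapP=> -[x' y] /=; rewrite mem_filter /= => /andP[/andP[cx cy] _] ->.
  rewrite /crossing linearZ linearD !linearZ /=.
  have xy : 0 < f y - f x' by rewrite subr_gt0 (lt_le_trans cx).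
  by rewrite mulrC ler_pdivlMr // le_eqVlt; apply/orP; left; apply/eqP; ring.
apply: hull_trans vt => x.
rewrite mem_cat mem_filter => /orP[/andP[_ xs]|]; first exact: mem_hull.
case/mapP=> -[x' y] /=; rewrite mem_filter /= => /andP[/andP[cx cy]].
case/allpairsP=> -[x1 y1] [/= xs ys [ex ey]] ->; move: xs ys; rewrite -ex -ey => xs ys {x1 y1 ex ey}.
rewrite /crossing scalerDr !scalerA /=.
have xy : 0 < f y - f x' by rewrite subr_gt0 (lt_le_trans cx).
apply: hull_segment => //.
- by rewrite mulr_ge0 ?invr_ge0 ?(ltW xy) // subr_ge0 ltW.
- by rewrite mulr_ge0 ?invr_ge0 ?(ltW xy) // subr_ge0.
- by field; rewrite gt_eqF.
Qed.

Lemma is_polytope_halfspace Q f (c : R) :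
  is_polytope Q -> is_polytope (Q `&` [set v | c <= f v]).
Proof. by move=> [s ->]; eexists; apply: hull_halfspace. Qed.

(** Half-spaces are cut off one at a time, so that bounded polyhedra given by
inequalities are hulls of finite sets. *)
Lemma is_polytope_halfspaces Q (I : Type) (r : seq I) (f : I -> {scalar V})
    (c : I -> R) : is_polytope Q ->
  is_polytope (Q `&` [set v | all (fun i => c i <= f i v) r]).
Proof.
move=> pQ; elim: r => [|i r IHr] /=.
  by rewrite (_ : [set _ | _] = setT) ?setIT //; apply/seteqP.
have := is_polytope_halfspace (f i) (c i) IHr.
congr is_polytope; rewrite -setIA; congr (_ `&` _).
by apply/seteqP; split => v /=; [move=> [-> ->]|move=> /andP[]].
Qed.

Lemma is_polytope_translate Q (t : V) :
  is_polytope Q -> is_polytope [set v + t | v in Q].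
Proof.
move=> [s ->]; exists [seq x + t | x <- s]; apply/seteqP; split => [_ [v + <-]|v].
  move=> [a [a0 a1 ->]].
  rewrite -[t in X in hull _ X]scale1r -a1 scaler_suml -big_split /=.
  under eq_bigr do rewrite -scalerDr.
  by apply: hull_sum => // i _; apply: map_f; rewrite mem_nth.
move=> [a [a0 a1 ->]]; exists (\sum_i a i *: ([seq x + t | x <- s]`_i - t)).
  apply: hull_sum => // i _.
  have si : (i < size s)%N by apply: leq_trans (ltn_ord i) _; rewrite size_map.
  by rewrite (nth_map 0) // addrK mem_nth.
under eq_bigr do rewrite scalerBr.
by rewrite big_split /= sumrN -scaler_suml a1 scale1r subrK.
Qed.

End Hulls.

Section Box.
Variables (R : realType) (n : nat).

(** A box is cut out of a large cross-polytope, whose vertices are multiples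
of the coordinate vectors. *)
Lemma box_sub_polytope (M : R) : exists2 Q : set 'rV[R]_n.+1, is_polytope Q &
  [set v : 'rV[R]_n.+1 | forall j, `|v 0 j| <= M] `<=` Q.
Proof.
pose N := n.+1%:R * Num.max M 1.
have N0 : 0 < N by rewrite mulr_gt0 ?ltr0n // lt_max ltr01 orbT.
pose e (b : bool) (j : 'I_n.+1) : 'rV[R]_n.+1 := ((-1) ^+ b * N) *: delta_mx 0 j.
pose s := [seq e p.1 p.2 | p : bool * 'I_n.+1].
exists (hull s); first by exists s.
move=> v /= vM.
(* The missing weight is spread evenly over pairs of opposite vertices, which cancel. *)
pose sl := (1 - \sum_j `|v 0 j| / N) / (2 * n.+1%:R).
have sl0 : 0 <= sl.
  rewrite divr_ge0 // subr_ge0 -mulr_suml ler_pdivrMr // mul1r /N.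
  have : \sum_j `|v 0 j| <= \sum_(j < n.+1) Num.max M 1.
    by apply: ler_sum => j _; rewrite le_max vM.
  by rewrite sumr_const card_ord -(mulr_natl (Num.max _ _)).
pose a (p : bool * 'I_n.+1) := (`|v 0 p.2| + (-1) ^+ p.1 * v 0 p.2) / (2 * N) + sl.
have Ev : v = \sum_p a p *: e p.1 p.2.
  rewrite -(pair_big xpredT xpredT (fun b j => a (b, j) *: e b j)) /= big_bool /=.
  rewrite -big_split /= {1}[v]row_sum_delta; apply: eq_bigr => j _.
  rewrite /e !scalerA -scalerDl; congr (_ *: _); rewrite /a /= expr0 expr1.
  by field; rewrite gt_eqF.
rewrite Ev; apply: hull_sum => [p _|p _|].
- apply: addr_ge0 => //; apply: divr_ge0; last by apply: mulr_ge0; rewrite ?(ltW N0).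
  have := ler_norm (v 0 p.2); have := ler_norm (- v 0 p.2); rewrite normrN.
  by case: p.1; rewrite /= ?expr1 ?expr0; lra.
- by apply: (map_f (fun p => e p.1 p.2)); rewrite mem_enum.
- rewrite -(pair_big xpredT xpredT (fun b j => a (b, j))) /= big_bool /=.
  rewrite -big_split /=.
  rewrite (eq_bigr (fun j => `|v 0 j| / N + 2 * sl)); last first.
    by move=> j _; rewrite /a /= expr0 expr1; field; rewrite gt_eqF.
  rewrite big_split /= sumr_const card_ord -mulr_natl /sl.
  by field; rewrite nat1r pnatr_eq0.
Qed.

End Box.

(** * Golden numbers and golden vertices *)

Section GoldenNumbers.
Variable R : realType.

Lemma phi_sqr : phi R ^+ 2 = phi R + 1.
Proof.
rewrite /phi; have := @sqr_sqrtr R 5 (ler0n _ 5).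
set s := Num.sqrt 5 => s2; by rewrite expr_div_n sqrrD s2; field.
Qed.

Lemma phi_bounds : 8 / 5 < phi R < 13 / 8.
Proof.
have := phi_sqr; set p := phi R => p2.
have p0 : 0 < p by rewrite /p /phi divr_gt0 // ltr_wpDr ?sqrtr_ge0.
by apply/andP; split; nra.
Qed.

Lemma phi_gt0 : 0 < phi R.
Proof. by have /andP[] := phi_bounds; lra. Qed.

Lemma phi_neq0 : phi R != 0.
Proof. by rewrite gt_eqF ?phi_gt0. Qed.

Lemma phi_inv : (phi R)^-1 = phi R - 1.
Proof.
apply: (mulfI phi_neq0); rewrite divff ?phi_neq0 // mulrBr mulr1 -expr2 phi_sqr.
by rewrite addrC addrA addNr add0r.
Qed.

Definition goldenp : {pred R} := [pred x | `[< Zphi x >]].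

Lemma goldenP x : reflect (Zphi x) (x \in goldenp).
Proof. exact: asboolP. Qed.

Fact goldenp_subring_closed : subring_closed goldenp.
Proof.
split.
- by apply/goldenP; exists 1, 0; rewrite mul0r addr0.
- move=> _ _ /goldenP[m [n ->]] /goldenP[m' [n' ->]]; apply/goldenP.
  by exists (m - m'), (n - n'); rewrite !rmorphB /=; ring.
- move=> _ _ /goldenP[m [n ->]] /goldenP[m' [n' ->]]; apply/goldenP.
  exists (m * m' + n * n'), (m * n' + n * m' + n * n').
  rewrite !rmorphD !rmorphM /=; have := phi_sqr; set p := phi R => p2.
  transitivity (m%:~R * m'%:~R + (m%:~R * n'%:~R + n%:~R * m'%:~R) * p + n%:~R * n'%:~R * p ^+ 2).
    by ring.
  by rewrite p2; ring.
Qed.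

HB.instance Definition _ :=
  GRing.isSubringClosed.Build R goldenp goldenp_subring_closed.

End GoldenNumbers.

Section Forms.
Variables (R : realType) (n : nat).
Implicit Types u v w : 'rV[R]_n.

Definition dot u v : R := \sum_i u 0 i * v 0 i.

Fact dot_linear u : linear_for *%R (dot u).
Proof.
move=> a v w; rewrite /dot mulr_sumr -big_split; apply: eq_bigr => i _ /=.
by rewrite !mxE; ring.
Qed.

HB.instance Definition _ u :=
  GRing.isLinear.Build R 'rV[R]_n R *%R (dot u) (dot_linear u).

Lemma dotDr u v w : dot u (v + w) = dot u v + dot u w.
Proof. exact: linearD. Qed.

Lemma dotBr u v w : dot u (v - w) = dot u v - dot u w.
Proof. exact: linearB. Qed.

Lemma dotZr u (a : R) w : dot u (a *: w) = a * dot u w.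
Proof. exact: linearZ. Qed.

Lemma dotNl u w : dot (- u) w = - dot u w.
Proof. by rewrite /dot -sumrN; apply: eq_bigr => i _; rewrite mxE mulNr. Qed.

Lemma dot_delta i w : dot (delta_mx 0 i) w = w 0 i.
Proof.
rewrite /dot (bigD1 i) //= big1 => [|j ji]; first by rewrite !mxE !eqxx mul1r addr0.
by rewrite mxE (negPf ji) andbF mul0r.
Qed.

Lemma dot_continuous u : continuous (dot u).
Proof.
move=> v.
apply: (@continuous_big _ _ _ _ _ _ _ _ (fun i (w : 'rV[R]_n) => u 0 i * w 0 i)).
  exact: add_continuous.
move=> i _ w; apply: (@continuousM _ _ (fun=> u 0 i) (fun w : 'rV[R]_n => w 0 i)); [exact: cst_continuous|exact: coord_continuous].
Qed.

Lemma nbhs_step v (A : set 'rV[R]_n) u : nbhs v A ->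
  exists2 e : R, 0 < e & forall t, `|t| <= e -> A (v + t *: u).
Proof.
move=> /rV_nbhsP[e e0 He]; pose s := 1 + \sum_i `|u 0 i|.
have s0 : 0 < s by rewrite ltr_wpDr // sumr_ge0.
have us i : `|u 0 i| < s.
  rewrite /s (bigD1 i) //= addrCA ltrDl ltr_wpDr // sumr_ge0 //.
exists (e / s) => [|t te]; first by rewrite divr_gt0.
apply: He => j; rewrite !mxE (addrC (v 0 j)) addrK normrM.
apply: le_lt_trans (ler_wpM2r _ te) _ => //.
by rewrite mulrAC ltr_pdivrMr // ltr_pM2l.
Qed.

Lemma dot_gt_open (J : finType) (nu : J -> 'rV[R]_n) (c : J -> R) (P : pred J) v :
  (forall j, P j -> c j < dot (nu j) v) ->
  nbhs v [set w | forall j, P j -> c j < dot (nu j) w].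
Proof.
move=> cv.
apply: (@filter_forall _ J (fun j => [set w | P j -> c j < dot (nu j) w]) (nbhs v)) => j.
case Pj: (P j); last by apply: filterS filterT => w _.
have H : (dot (nu j) @ v) (fun x => c j < x) := @dot_continuous (nu j) v _ (lt_nbhsr (cv j Pj)).
by apply: (@filterS _ _ _ (fun w => c j < dot (nu j) w)) => [w /= ? _|]; [|exact: H].
Qed.

End Forms.

Section GoldenVertices.
Variables (R : realType) (n : nat) (J : finType).
Variables (nu : J -> 'rV[R]_n) (lo hi : J -> R).

Definition slabs : set 'rV[R]_n := [set v | forall j, lo j <= dot (nu j) v <= hi j].

(** At an extreme point the normals of the tight constraints span the whole
space, for otherwise one could move both ways in a direction orthogonal to
them.  The point is thus the solution of a square system with golden
coefficients, and the solution is golden when the determinant is a unit. *)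
Lemma golden_slabs :
  (forall j, golden_vector (nu j)) -> (forall j, Zphi (lo j) /\ Zphi (hi j)) ->
  (forall f : 'I_n -> J, let D := \det (\matrix_(i, l) nu (f i) 0 l) in
     D != 0 -> Zphi D^-1) ->
  golden_polytope slabs.
Proof.
move=> gnu gb gD v [vS ve].
pose tight j := (dot (nu j) v == lo j) || (dot (nu j) v == hi j).
pose N : 'M[R]_(#|J|, n) :=
  \matrix_(k, l) if tight (enum_val k) then nu (enum_val k) 0 l else 0.
have Nfull : row_full N.
  rewrite -cokermx_eq0; apply/negPn/negP => /eqP Nco.
  have [l [j /eqP colj]] : exists l j, cokermx N l j <> 0.
    apply: contrapT => H; apply: Nco; apply/matrixP => l j; rewrite [RHS]mxE.
    by apply: contrapT => H'; apply: H; exists l, j.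
  pose u := (col j (cokermx N))^T.
  have u_tight k : tight k -> dot (nu k) u = 0.
    move=> tk; have /matrixP/(_ (enum_rank k) j) := mulmx_coker N.
    rewrite !mxE => E; rewrite -[RHS]E; apply: eq_bigr => i _.
    by rewrite !mxE enum_rankK tk.
  have slack : nbhs v [set w | forall k, ~~ tight k -> lo k < dot (nu k) w < hi k].
    have [H1 H2] : nbhs v [set w | forall k, ~~ tight k -> lo k < dot (nu k) w] /\
       nbhs v [set w | forall k, ~~ tight k -> - hi k < dot (- nu k) w].
      by split; apply: dot_gt_open => k; rewrite /tight ?dotNl negb_or => /andP[a b];
        have /andP[c d] := vS k; rewrite ?ltrN2 lt_neqAle ?c ?d andbT // eq_sym.
    apply: filterS2 H1 H2 => w H1 H2 k tk; rewrite H1 //=.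
    by have := H2 k tk; rewrite dotNl ltrN2.
  have [e e0 He] := nbhs_step u slack.
  have vu t : `|t| <= e -> slabs (v + t *: u).
    move=> te k; have [tk|tk] := boolP (tight k).
      by rewrite dotDr dotZr u_tight // mulr0 addr0; exact: vS.
    by have /andP[a b] := He t te k tk; rewrite !ltW.
  have : v + e *: u = v + (- e) *: u.
    apply: ve; first by apply: vu; rewrite ger0_norm // ltW.
      by apply: vu; rewrite normrN ger0_norm // ltW.
    by apply/matrixP => i k; rewrite !mxE; field.
  move=> /addrI/eqP; rewrite -subr_eq0 -scalerBl opprK scaler_eq0 => /orP[|/eqP u0].
    by rewrite -mulr2n mulrn_eq0 /= gt_eqF.
  by move: colj; have /matrixP/(_ 0 l) := u0; rewrite !mxE => -> /eqP.
pose f := fullrankfun Nfull; pose B := rowsub f N.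
have Bu : B \in unitmx := fullrowsub_unit Nfull.
have ft i : tight (enum_val (f i)).
  apply: contraTT Bu => /negPf ti; rewrite unitmxE unitfE negbK.
  rewrite (expand_det_row _ i) big1 // => k _; rewrite !mxE ti mul0r //.
have EB : B = \matrix_(i, l) nu (enum_val (f i)) 0 l.
  by apply/matrixP => i l; rewrite !mxE ft.
have gBi : forall i l, invmx B i l \in @goldenp R.
  move=> i l; rewrite /invmx Bu mxE rpredM //.
    by apply/goldenP; rewrite EB; apply: gD; rewrite -EB -unitfE -unitmxE.
  rewrite mxE /cofactor rpredM // ?rpredX ?rpredN ?rpred1 //.
  rewrite /determinant rpred_sum // => s _; rewrite rpredM ?rpredX ?rpredN ?rpred1 //.
  by apply: rpred_prod => k _; rewrite EB !mxE; apply/goldenP; exact: gnu.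
move=> l; apply/goldenP.
have -> : v 0 l = (invmx B *m (B *m v^T)) l 0 by rewrite mulKmx // mxE.
rewrite mxE rpred_sum // => i _; rewrite rpredM //.
have -> : (B *m v^T) i 0 = dot (nu (enum_val (f i))) v.
  by rewrite EB mxE; apply: eq_bigr => k _; rewrite !mxE.
have [gl gh] := gb (enum_val (f i)).
by apply/goldenP; have /orP[/eqP->|/eqP->] := ft i.
Qed.

End GoldenVertices.

(** * Exchange maps from bijections of the torus *)

Section Slabs.
Variables (R : realType) (n : nat) (J : finType).
Variables (nu : J -> 'rV[R]_n) (d : 'rV[R]_n).
Hypothesis d_pos : forall j, 0 < dot (nu j) d.
Implicit Types (lo hi : J -> R) (v : 'rV[R]_n).

Definition open_slabs lo hi : set 'rV[R]_n :=
  [set v | forall j, lo j < dot (nu j) v < hi j].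

Definition half_open_slabs lo hi : set 'rV[R]_n :=
  [set v | forall j, lo j <= dot (nu j) v < hi j].

Lemma open_slabsW lo hi : open_slabs lo hi `<=` half_open_slabs lo hi.
Proof. by move=> v vS j; have /andP[/ltW -> ->] := vS j. Qed.

Lemma half_open_slabsW lo hi : half_open_slabs lo hi `<=` slabs nu lo hi.
Proof. by move=> v vS j; have /andP[-> /ltW ->] := vS j. Qed.

Lemma open_open_slabs lo hi : open (open_slabs lo hi).
Proof.
rewrite openE => v vS.
have H1 : nbhs v [set w | forall j, xpredT j -> lo j < dot (nu j) w].
  by apply: dot_gt_open => j _; have /andP[] := vS j.
have H2 : nbhs v [set w | forall j, xpredT j -> - hi j < dot (- nu j) w].
  by apply: dot_gt_open => j _; rewrite dotNl ltrN2; have /andP[] := vS j.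
apply: filterS2 H1 H2 => w H1 H2 j; rewrite H1 //=.
by have := H2 j isT; rewrite dotNl ltrN2.
Qed.

(** Every form increases in the direction d, so that a small step along d
leaves the lower boundary of a half-open cell and stays below the upper one. *)
Lemma half_open_slabs_step lo hi v : half_open_slabs lo hi v ->
  open_slabs lo hi !=set0.
Proof.
move=> vS.
have H2 : nbhs v [set w | forall j, xpredT j -> - hi j < dot (- nu j) w].
  by apply: dot_gt_open => j _; rewrite dotNl ltrN2; have /andP[] := vS j.
have [e e0 He] := nbhs_step d H2.
exists (v + e *: d) => j; apply/andP; split.
  have /andP[lv _] := vS j; rewrite dotDr dotZr.
  by apply: le_lt_trans lv _; rewrite ltrDl mulr_gt0.
by have := He e _ j isT; rewrite dotNl ltrN2; apply; rewrite (ger0_norm (ltW e0)).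
Qed.

(** Moving by small positive and negative multiples of d, a point of the
interior sees that none of its constraints is tight. *)
Lemma interior_slabs lo hi : (slabs nu lo hi)° = open_slabs lo hi.
Proof.
apply/seteqP; split; last first.
  rewrite -open_subsetE; last exact: open_open_slabs.
  by apply: subset_trans (@half_open_slabsW _ _); exact: open_slabsW.
move=> v /(nbhs_step d)[e e0 He] j.
have /He/(_ j)/andP[_ h] : `|e| <= e by rewrite ger0_norm // ltW.
have /He/(_ j)/andP[l _] : `|- e| <= e by rewrite normrN ger0_norm // ltW.
have de : 0 < e * dot (nu j) d by rewrite mulr_gt0.
move: h l; rewrite !dotDr !dotZr mulNr => h l.
by apply/andP; split; lra.
Qed.

End Slabs.

Section Translate.
Variables (R : realType) (n : nat).
Implicit Types (Q : set 'rV[R]_n) (t : 'rV[R]_n).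

Lemma interior_translate Q t : [set v + t | v in Q]° = [set v + t | v in Q°].
Proof.
apply/seteqP; split => [v|_ [v + <-]].
  move=> /rV_nbhsP[e e0 He]; exists (v - t); last by rewrite subrK.
  apply/rV_nbhsP; exists e => // w Hw.
  have [|u Qu /addIr <- //] := He (w + t) => [j].
  by rewrite !mxE; have := Hw j; rewrite !mxE opprB addrA.
move=> /rV_nbhsP[e e0 He]; apply/rV_nbhsP; exists e => // w Hw.
exists (w - t); last by rewrite subrK.
apply: He => j; rewrite !mxE; have := Hw j; rewrite !mxE.
by congr (`|_| < _); ring.
Qed.

Lemma golden_translate Q t : golden_vector t -> golden_polytope Q ->
  golden_polytope [set v + t | v in Q].
Proof.
move=> gt gQ _ [[v Qv <-] ve] j; rewrite mxE.
apply/goldenP; rewrite rpredD //; apply/goldenP; last exact: gt.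
apply: gQ; split => // a b Qa Qb ab; apply: (addIr t); apply: ve.
- by exists a.
- by exists b.
- rewrite addrACA scalerDr -ab; congr (_ + _); apply/matrixP => k l; rewrite !mxE.
  by field.
Qed.

End Translate.

Section ExchangeOfBijection.
Variables (R : realType) (n : nat) (J K : finType).
Local Notation V := 'rV[R]_n.+1.
Local Notation T := (torus R n.+1).
Variables (nu : J -> V) (d : V) (lo hi : K -> J -> R) (sh : K -> V) (g : T -> T).
Variables (c : 'I_n.+1 -> R).

(** Cells come in three versions.  The half-open ones partition the torus, the
closed ones are the polytopes, the open ones are their interiors. *)
Definition cell k := slabs nu (lo k) (hi k).
Definition half_open_cell k := half_open_slabs nu (lo k) (hi k).
Definition open_cell k := open_slabs nu (lo k) (hi k).

Hypothesis d_pos : forall j, 0 < dot (nu j) d.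
Hypothesis cell_box : forall k i,
  exists j, [/\ nu j = delta_mx 0 i, lo k j = c i & hi k j = c i + 2].
Hypothesis cell_disjoint : forall k k' v,
  half_open_cell k v -> half_open_cell k' v -> k = k'.
Hypothesis cell_cover : forall t : T,
  exists k v, half_open_cell k v /\ t = \pi_T v.
Hypothesis g_inj : injective g.
Hypothesis g_surj : forall t, exists t', t = g t'.
Hypothesis g_shift : forall k v, half_open_cell k v ->
  g (\pi_T v) = \pi_T (v + sh k).
Hypothesis nu_golden : forall j, golden_vector (nu j).
Hypothesis bounds_golden : forall k j, Zphi (lo k j) /\ Zphi (hi k j).
Hypothesis sh_golden : forall k, golden_vector (sh k).
Hypothesis unit_minors : forall f : 'I_n.+1 -> J,
  let D := \det (\matrix_(i, l) nu (f i) 0 l) in D != 0 -> Zphi D^-1.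

(** All cells lie in one half-open box of side 2, a fundamental domain. *)
Lemma half_open_cell_inj k k' v v' : half_open_cell k v -> half_open_cell k' v' ->
  \pi_T v = \pi_T v' -> v = v'.
Proof.
move=> kv kv' /torus_piE/even_latticeP vv'; apply/matrixP => i j; rewrite ord1.
have := vv' j; rewrite !mxE => -[m Hm].
have [a [Ea la ha]] := cell_box k j; have [b [Eb lb hb]] := cell_box k' j.
have := kv a; rewrite la ha Ea dot_delta => /andP[x1 x2].
have := kv' b; rewrite lb hb Eb dot_delta => /andP[y1 y2].
have m0 : m = 0 by apply: (@int_near0 R); lra.
by apply/eqP; rewrite -subr_eq0 Hm m0 mulr0.
Qed.

(* Only cells with nonempty interior are kept; by half_open_slabs_step these are
exactly the cells whose half-open version is nonempty. *)
Definition cell_index := [pred k | `[< open_cell k !=set0 >]].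
Definition cell_of (i : 'I_#|cell_index|) : K := enum_val i.

Lemma cell_ofP k : open_cell k !=set0 -> exists i, cell_of i = k.
Proof.
move=> k0; have kI : k \in cell_index by apply/asboolP.
by exists (enum_rank_in kI k); rewrite /cell_of enum_rankK_in.
Qed.

Lemma cell_of_nonempty i : open_cell (cell_of i) !=set0.
Proof. by apply/asboolP; have := enum_valP i. Qed.

Lemma cell_lifted k : open_cell k !=set0 -> lifted_polytope (cell k).
Proof.
move=> k0; split; last 2 first.
- by rewrite (interior_slabs d_pos).
- rewrite (interior_slabs d_pos) => v w /set_mem vS /set_mem wS.
  exact: half_open_cell_inj (open_slabsW vS) (open_slabsW wS).
pose M := 2 + \sum_i `|c i|.
have [Q pQ MQ] := @box_sub_polytope R n M.
have QE : cell k `<=` Q.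
  move=> v kv; apply: MQ => i.
  have [a [Ea la ha]] := cell_box k i.
  have := kv a; rewrite la ha Ea dot_delta => /andP[x1 x2].
  have : `|c i| <= \sum_i `|c i| by rewrite (bigD1 i) //= lerDl sumr_ge0.
  have := ler_norm (c i); have := ler_norm (- c i); rewrite normrN /M.
  by move=> h1 h2 h3; rewrite ler_norml; apply/andP; split; lra.
have := is_polytope_halfspaces (enum {: J * bool})
  (fun p => dot (if p.2 then nu p.1 else - nu p.1))
  (fun p => if p.2 then lo k p.1 else - hi k p.1) pQ.
congr is_polytope; apply/seteqP; split => [v [Qv /allP H] j|v kv].
  apply/andP; split; first by have := H (j, true); rewrite mem_enum; exact.
  by have := H (j, false); rewrite mem_enum /= dotNl lerN2; exact.
split; first exact: QE.
by apply/allP => -[j b] _ /=; have /andP[] := kv j; case: b; rewrite ?dotNl ?lerN2.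
Qed.

Lemma open_cell_disjoint k k' v v' : open_cell k v -> open_cell k' v' ->
  \pi_T v = \pi_T v' -> k = k'.
Proof.
move=> /open_slabsW kv /open_slabsW kv' vv'.
have vv := half_open_cell_inj kv kv' vv'.
by apply: cell_disjoint kv _; rewrite vv.
Qed.

Lemma cells_partition : torus_partition (cell \o cell_of).
Proof.
split => [i||].
- exact/cell_lifted/cell_of_nonempty.
- apply/seteqP; split => // t _.
  have [k [v [kv ->]]] := cell_cover t.
  have [i ik] := cell_ofP (half_open_slabs_step d_pos kv).
  by exists i => //; exists v => //=; rewrite ik; exact: half_open_slabsW.
- apply/trivIsetP => i j _ _ ij; apply/seteqP; split => // t [].
  rewrite /= !(interior_slabs d_pos) => -[v vi <-] [w wj] wv.
  have /enum_val_inj ji := open_cell_disjoint wj vi wv.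
  by rewrite ji eqxx in ij.
Qed.

Definition moved_cell k := [set v + sh k | v in cell k].

(** The translated cells cover because g is onto, and have disjoint interiors
because g is injective. *)
Lemma moved_cells_partition : torus_partition (moved_cell \o cell_of).
Proof.
have int i : (moved_cell i)° = [set v + sh i | v in open_cell i].
  by rewrite interior_translate (interior_slabs d_pos).
have gE i v : open_cell i v -> \pi_T (v + sh i) = g (\pi_T v).
  by move=> /open_slabsW/g_shift.
split => [i||].
- have [p0 p1 p2] := cell_lifted (cell_of_nonempty i); split.
  + exact: is_polytope_translate p0.
  + by have [v vi] := cell_of_nonempty i; rewrite int; exists (v + sh (cell_of i)); exists v.
  + rewrite int => _ _ /set_mem[v vi <-] /set_mem[w wi <-]; rewrite !gE //.
    move=> /g_inj vw; congr (_ + _).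
    exact: half_open_cell_inj (open_slabsW vi) (open_slabsW wi) vw.
- apply/seteqP; split => // t _.
  have [t' ->] := g_surj t; have [k [v [kv ->]]] := cell_cover t'.
  have [i ik] := cell_ofP (half_open_slabs_step d_pos kv).
  exists i => //; exists (v + sh k); last by rewrite (g_shift kv).
  by rewrite /= ik; exists v => //; exact: half_open_slabsW.
- apply/trivIsetP => i j _ _ ij; apply/seteqP; split => // t [].
  rewrite /= !int => -[_ [v vi <-] <-] [_ [w wj <-]]; rewrite !gE // => /g_inj wv.
  have /enum_val_inj ji := open_cell_disjoint wj vi wv.
  by rewrite ji eqxx in ij.
Qed.

Lemma pieces_interior_cells :
  pieces_interior (cell \o cell_of) = \bigcup_k ((\pi_T : V -> T) @` open_cell k).
Proof.
apply/seteqP; split => t [i _ [v /= vi <-]].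
  by rewrite (interior_slabs d_pos) in vi; exists (cell_of i) => //; exists v.
have [|j ji] := @cell_ofP i; first by exists v.
by exists j => //; exists v => //=; rewrite ji (interior_slabs d_pos).
Qed.

Lemma cells_bij : set_bij (pieces_interior (cell \o cell_of))
  (pieces_interior (moved_cell \o cell_of)) g.
Proof.
split; last 1 first.
- move=> _ [i _ [v + <-]]; rewrite /= interior_translate (interior_slabs d_pos).
  move=> [w wi <-]; exists (\pi_T w); last exact/g_shift/open_slabsW.
  by exists i => //; exists w => //=; rewrite (interior_slabs d_pos).
- move=> _ [i _ [v + <-]]; rewrite /= (interior_slabs d_pos) => vi.
  exists i => //; exists (v + sh (cell_of i)); last by rewrite (g_shift (open_slabsW vi)).
  by rewrite /= interior_translate (interior_slabs d_pos); exists v.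
- by move=> ? ? _ _ /g_inj.
Qed.

Theorem exchange_of_bijection : exists E : polytope_exchange R n.+1,
  [/\ golden E, E = g :> (T -> T),
      exchange_domain E = \bigcup_k ((\pi_T : V -> T) @` open_cell k),
      forall i, exists k, [/\ open_cell k !=set0, @source _ _ E i = cell k &
                              @Defs.shift _ _ E i = sh k] &
      forall k, open_cell k !=set0 ->
        exists i, @source _ _ E i = cell k /\ @Defs.shift _ _ E i = sh k].
Proof.
have Eshift i v : ((cell \o cell_of) i)° v -> g (\pi_T v) = \pi_T (v + sh (cell_of i)).
  by rewrite /= (interior_slabs d_pos) => /open_slabsW/g_shift.
pose E := PolytopeExchange cells_partition moved_cells_partition cells_bij Eshift
  (fun i => ex_intro _ i erefl).
exists E; split => //=; last 3 first.
- exact: pieces_interior_cells.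
- by move=> i; exists (cell_of i); split => //; exact: cell_of_nonempty.
- by move=> k /cell_ofP[i <-]; exists i.
have gc i : golden_polytope (cell i).
  by apply: golden_slabs => // j; exact: bounds_golden.
by split => i //=; exact: golden_translate.
Qed.

End ExchangeOfBijection.

(** * Computing in the golden ring *)

(** The pair (a, b) stands for a + b phi, so that identities and inequalities
between explicit golden numbers are decided by evaluation. *)
Definition zphi := (Z * Z)%type.

Definition zcst (a : Z) : zphi := (a, Z0).
Definition zadd (x y : zphi) : zphi := (x.1 + y.1, x.2 + y.2)%Zc.
Definition zopp (x : zphi) : zphi := (- x.1, - x.2)%Zc.
Definition zmul (x y : zphi) : zphi :=
  (x.1 * y.1 + x.2 * y.2, x.1 * y.2 + x.2 * y.1 + x.2 * y.2)%Zc.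
Definition zeq (x y : zphi) : bool := Z.eqb x.1 y.1 && Z.eqb x.2 y.2.

(** The sign of a + b phi = (p + b sqrt 5) / 2, with p = 2a + b, is found by
comparing the squares of p and of b sqrt 5. *)
Definition zpos (x : zphi) : bool :=
  let p := (2 * x.1 + x.2)%Zc in let q := x.2 in
  if Z.leb 0 p then
    if Z.leb 0 q then Z.ltb 0 (p + q) else Z.ltb (5 * (q * q)) (p * p)
  else Z.leb 0 q && Z.ltb (p * p) (5 * (q * q)).

(** Golden numbers of norm 1 or -1 are the units of Z[phi]. *)
Definition znorm (x : zphi) : Z := (x.1 * x.1 + x.1 * x.2 - x.2 * x.2)%Zc.
Definition zunit_or_zero (x : zphi) : bool :=
  [|| zeq x (zcst 0), Z.eqb (znorm x) 1 | Z.eqb (znorm x) (-1)].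

Section Evaluation.
Variable R : realType.

Definition zr (a : Z) : R := (int_of_Z a)%:~R.
Definition zval (x : zphi) : R := zr x.1 + zr x.2 * phi R.

Lemma zrD a b : zr (a + b)%Zc = zr a + zr b.
Proof. by rewrite /zr (rmorphD int_of_Z) rmorphD. Qed.
Lemma zrN a : zr (- a)%Zc = - zr a.
Proof. by rewrite /zr (rmorphN int_of_Z) rmorphN. Qed.
Lemma zrM a b : zr (a * b)%Zc = zr a * zr b.
Proof. by rewrite /zr (rmorphM int_of_Z) rmorphM. Qed.
Lemma zr_le a b : Z.leb a b -> zr a <= zr b.
Proof. by move=> ab; rewrite /zr ler_int; lia. Qed.
Lemma zr_lt a b : Z.ltb a b -> zr a < zr b.
Proof. by move=> ab; rewrite /zr ltr_int; lia. Qed.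

Lemma zval_golden x : Zphi (zval x).
Proof. by exists (int_of_Z x.1), (int_of_Z x.2). Qed.

Lemma zvalD x y : zval (zadd x y) = zval x + zval y.
Proof. by rewrite /zval !zrD; ring. Qed.
Lemma zvalN x : zval (zopp x) = - zval x.
Proof. by rewrite /zval !zrN; ring. Qed.
Lemma zvalM x y : zval (zmul x y) = zval x * zval y.
Proof.
rewrite /zval !zrD !zrM; have := phi_sqr R; set p := phi R => p2.
transitivity (zr x.1 * zr y.1 + (zr x.1 * zr y.2 + zr x.2 * zr y.1) * p
  + zr x.2 * zr y.2 * (p + 1)); first by ring.
by rewrite -p2; ring.
Qed.

Lemma zvalE x y : zeq x y -> zval x = zval y.
Proof. by case: x y => [a b] [a' b'] /andP[/= /Z.eqb_eq -> /Z.eqb_eq ->]. Qed.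

Lemma zval_cst a : zval (zcst a) = zr a.
Proof. by rewrite /zval /= [zr Z0](_ : _ = 0) // mul0r addr0. Qed.

Lemma zposP x : zpos x -> 0 < zval x.
Proof.
case: x => a b; rewrite /zpos /= => H.
pose s : R := Num.sqrt 5.
have s2 : s ^+ 2 = 5 by rewrite sqr_sqrtr.
have s0 : 0 < s by rewrite sqrtr_gt0.
set p := (2 * a + b)%Zc in H.
have Ep : zr p = 2 * zr a + zr b by rewrite /p zrD zrM.
have -> : zval (a, b) = (zr p + zr b * s) / 2 by rewrite /zval /phi -/s Ep /=; field.
rewrite divr_gt0 //.
have zr0 : zr Z0 = 0 by [].
move: H; case: ifPn => [/zr_le|]; rewrite ?zr0 => p0.
  case: ifPn => [/zr_le|]; rewrite ?zr0 => b0.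
    by move=> /zr_lt; rewrite zrD zr0 => pb; nra.
  have {}b0 : zr b < 0 by apply: (@zr_lt b Z0); lia.
  move=> /zr_lt; rewrite !zrM (_ : zr 5%Zc = 5) // => h.
  rewrite -subr_lt0 in h.
  have : (zr b * s) ^+ 2 < zr p ^+ 2 by rewrite exprMn s2; nra.
  nra.
have {}p0 : zr p < 0 by apply: (@zr_lt p Z0); lia.
move=> /andP[/zr_le + /zr_lt]; rewrite !zrM (_ : zr 5%Zc = 5) // zr0 => b0 h.
have : zr p ^+ 2 < (zr b * s) ^+ 2 by rewrite exprMn s2; nra.
have : 0 <= zr b * s by rewrite mulr_ge0 // ltW.
set t := zr b * s => t0 tp; nra.
Qed.

(** The inverse of a unit is its conjugate up to sign. *)
Lemma zunit_or_zeroP x : zunit_or_zero x -> zval x != 0 -> Zphi (zval x)^-1.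
Proof.
pose y : zphi := (x.1 + x.2, - x.2)%Zc.
have xy : zval x * zval y = zr (znorm x).
  rewrite -zvalM -zval_cst; apply: zvalE; rewrite /zeq /znorm /zmul /y /=.
  by apply/andP; split; lia.
move=> /or3P[/zvalE ->|/Z.eqb_eq nx|/Z.eqb_eq nx] x0; first by rewrite zval_cst eqxx in x0.
  rewrite (_ : _^-1 = zval y); first exact: zval_golden.
  by apply: (mulfI x0); rewrite divff // xy nx.
rewrite (_ : _^-1 = zval (zopp y)); first exact: zval_golden.
by apply: (mulfI x0); rewrite divff // zvalN mulrN xy nx (_ : zr (Zneg xH) = -1) ?opprK.
Qed.

Definition zrow n (s : seq zphi) : 'rV[R]_n := \row_j zval (nth (zcst 0) s j).

Definition zdot n (s t : seq zphi) : zphi :=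
  foldr (fun i acc => zadd (zmul (nth (zcst 0) s i) (nth (zcst 0) t i)) acc) (zcst 0) (iota 0 n).

Lemma zrow_golden n s : golden_vector (zrow n s).
Proof. by move=> j; rewrite mxE; exact: zval_golden. Qed.

Lemma dot_zrow n s t : dot (zrow n s) (zrow n t) = zval (zdot n s t).
Proof.
rewrite /dot (eq_bigr (fun i : 'I_n => zval (nth (zcst 0) s i) * zval (nth (zcst 0) t i))).
  rewrite -(big_mkord xpredT (fun i => zval (nth (zcst 0) s i) * zval (nth (zcst 0) t i))).
  rewrite /zdot /index_iota subn0; elim: (iota 0 n) => [|i r IHr].
    by rewrite big_nil /= zval_cst.
  by rewrite big_cons IHr /= zvalD zvalM.
by move=> i _; rewrite !mxE.
Qed.

End Evaluation.

Definition zdet2 (a b : seq zphi) : zphi :=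
  let e s i := nth (zcst 0) s i in
  zadd (zmul (e a 0%N) (e b 1%N)) (zopp (zmul (e a 1%N) (e b 0%N))).

Definition zdet3 (a b c : seq zphi) : zphi :=
  let e s i := nth (zcst 0) s i in
  let m i j := zadd (zmul (e b i) (e c j)) (zopp (zmul (e b j) (e c i))) in
  zadd (zmul (e a 0%N) (m 1%N 2%N))
    (zadd (zopp (zmul (e a 1%N) (m 0%N 2%N))) (zmul (e a 2%N) (m 0%N 1%N))).

Lemma det_zrow2 (R : realType) (f : 'I_2 -> seq zphi) :
  \det (\matrix_(i, l) zrow R 2 (f i) 0 l) = zval R (zdet2 (f ord0) (f (lift ord0 ord0))).
Proof.
rewrite (expand_det_row _ ord0) !big_ord_recl big_ord0 /cofactor !det_mx11 !mxE /=.
by rewrite zvalD zvalN !zvalM /= expr0 expr1 /bump /= !addn0; ring.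
Qed.

Lemma det_zrow3 (R : realType) (f : 'I_3 -> seq zphi) :
  \det (\matrix_(i, l) zrow R 3 (f i) 0 l) =
  zval R (zdet3 (f ord0) (f (lift ord0 ord0)) (f (lift ord0 (lift ord0 ord0)))).
Proof.
rewrite (expand_det_row _ ord0) !big_ord_recl big_ord0 /cofactor.
rewrite !(expand_det_row _ ord0) !big_ord_recl !big_ord0 /cofactor !det_mx11 !mxE /=.
rewrite !(zvalD, zvalN, zvalM) /= /bump /= !addn0 !add1n /= expr0 expr1.
by ring.
Qed.

(** * Sliding through a chain of strips *)

(** Strip i is the slab off i <= f i < off i + 2, and U i crosses it exactly
once. *)
Section StripChain.
Variables (R : realType) (n : nat).
Local Notation V := 'rV[R]_n.
Variables (M : nat) (f U : nat -> V) (off : nat -> R).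

Definition strip_index i (v : V) : int := Num.floor ((dot (f i) v - off i) / 2).

Definition slide i (v : V) : V := v + (strip_index i v)%:~R *: U i.

Fixpoint slides i (v : V) : V := if i is j.+1 then slide j (slides j v) else v.

Lemma strip_indexP i v (m : int) :
  off i + 2 * m%:~R <= dot (f i) v < off i + 2 * m%:~R + 2 <-> strip_index i v = m.
Proof.
split=> [/andP[h1 h2]|<-].
  by apply: floor_def; rewrite ler_pdivlMr // ltr_pdivrMr // rmorphD /=; lra.
have := floor_itv ((dot (f i) v - off i) / 2).
rewrite -/(strip_index i v) ler_pdivlMr // ltr_pdivrMr // rmorphD /=.
by move=> /andP[h1 h2]; apply/andP; split; lra.
Qed.

Definition itinerary_shift (k : nat -> int) i : V := \sum_(j < i) (k j)%:~R *: U j.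

Lemma slides_itinerary (k : nat -> int) i v :
  (forall j, (j < i)%N -> strip_index j (slides j v) = k j) ->
  slides i v = v + itinerary_shift k i.
Proof.
elim: i => [|i IHi] kE; first by rewrite /itinerary_shift big_ord0 addr0.
rewrite /= /slide kE // IHi => [|j ji]; last by rewrite kE // ltnW.
by rewrite /itinerary_shift big_ord_recr /= addrA.
Qed.

(** Finitely many itineraries occur on a bounded set. *)
Lemma bounded_itinerary (box : set V) (b : R) :
  (forall v, box v -> forall l, `|v 0 l| <= b) ->
  exists N : nat, forall v i, box v -> (i < M)%N ->
    `|strip_index i (slides i v)|%:~R <= N%:R :> R.
Proof.
move=> boxb.
have dot_bound i (c : R) : exists c', forall v : V, (forall l, `|v 0 l| <= c) ->
    `|(strip_index i v)%:~R : R| <= c'.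
  exists ((\sum_l `|f i 0 l| * c + `|off i|) / 2 + 1) => v vc.
  have : `|dot (f i) v| <= \sum_l `|f i 0 l| * c.
    apply: le_trans (ler_norm_sum _ _ _) _; apply: ler_sum => l _.
    by rewrite normrM ler_wpM2l.
  have /strip_indexP/andP[] := erefl (strip_index i v).
  set s := _%:~R; set D := dot _ _; set S := \sum_l _ => h1 h2.
  rewrite !ler_norml => /andP[h3 h4].
  have := ler_norm (off i); have := ler_norm (- off i); rewrite normrN => h5 h6.
  by apply/andP; split; lra.
have slides_bound i : exists c, forall v, box v -> forall l, `|slides i v 0 l| <= c.
  elim: i => [|i [c Hc]]; first by exists b.
  have [c' Hc'] := dot_bound i c.
  exists (c + c' * \sum_l `|U i 0 l|) => v bv l; rewrite !mxE.
  apply: le_trans (ler_normD _ _) _; apply: lerD; first exact: Hc.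
  rewrite normrM ler_pM // ?Hc' //; first by move=> ?; exact: Hc.
  by rewrite (bigD1 l) //= lerDl sumr_ge0.
have /choice[c Hc] : forall i, exists c, forall v, box v ->
    `|(strip_index i (slides i v))%:~R : R| <= c.
  move=> i; have [c Hc] := slides_bound i; have [c' Hc'] := dot_bound i c.
  by exists c' => v bv; apply: Hc' => l; exact: Hc.
exists (Num.bound (\sum_(i < M) `|c i|)) => v i bv iM.
rewrite intr_norm; apply: le_trans (Hc i v bv) _; apply: le_trans (ler_norm _) _.
apply: le_trans (ltW (archi_boundP _)); last exact: sumr_ge0.
by rewrite (bigD1 (Ordinal iM)) //= lerDl sumr_ge0.
Qed.

Variables (p q : nat -> V) (al be ep : nat -> int).
Hypothesis fU : forall i, (i < M)%N -> dot (f i) (U i) = -2.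
Hypothesis fp : forall i, (i < M)%N -> dot (f i) (p i) = 2 * (al i)%:~R.
Hypothesis fq : forall i, (i < M)%N -> dot (f i) (q i) = 2 * (be i)%:~R.
Hypothesis pS : forall i, (i < M)%N -> p i.+1 = p i + (al i)%:~R *: U i.
Hypothesis qS : forall i, (i < M)%N -> q i.+1 = q i + (be i)%:~R *: U i.
Hypothesis fU' : forall i, (i < M)%N -> dot (f i) (U i.+1) = 2 * (ep i)%:~R.
Hypothesis ep_unit : forall i, (i < M)%N -> ep i * ep i = 1.

(** The lattice of the torus in which the i-th strip lives.  Its part
<p i.+1, q i.+1> orthogonal to f i is shared with the next lattice, which is
why sliding along U i induces a bijection between the two tori. *)
Definition chain_lattice i : set V :=
  [set v | exists a b c : int, v = a%:~R *: p i + b%:~R *: q i + c%:~R *: U i].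

Lemma slide_equivariant i u v : (i < M)%N ->
  chain_lattice i (u - v) -> chain_lattice i.+1 (slide i u - slide i v).
Proof.
move=> iM [a [b [c uv]]]; pose m := a * al i + b * be i - c.
have uE : u = v + (a%:~R *: p i + b%:~R *: q i + c%:~R *: U i) by rewrite -uv addrC subrK.
have sE : strip_index i u = strip_index i v + m.
  apply/strip_indexP; have /strip_indexP := erefl (strip_index i v).
  rewrite uE !dotDr !dotZr fp // fq // fU // /m !(rmorphD, rmorphN, rmorphM) /=.
  by move=> /andP[h1 h2]; apply/andP; split; lra.
exists a, b, 0; rewrite /slide sE pS // qS // uE /m.
by apply/matrixP => k l; rewrite !mxE !(rmorphD, rmorphN, rmorphM) /=; ring.
Qed.

Lemma dot_slide i v : (i < M)%N -> off i <= dot (f i) (slide i v) < off i + 2.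
Proof.
move=> iM; have /strip_indexP := erefl (strip_index i v).
rewrite /slide dotDr dotZr fU // => /andP[h1 h2]; apply/andP; split; lra.
Qed.

(** Both images lie in the strip, half-open of width 2, so that their difference
has no component along U i.+1, on which f i takes the value 2 or -2. *)
Lemma slide_reflects i u v : (i < M)%N ->
  chain_lattice i.+1 (slide i u - slide i v) -> chain_lattice i (u - v).
Proof.
move=> iM [a [b [c uv]]].
have /andP[u1 u2] := dot_slide u iM; have /andP[v1 v2] := dot_slide v iM.
have : dot (f i) (slide i u) - dot (f i) (slide i v) = 2 * (c * ep i)%:~R.
  rewrite -dotBr uv pS // qS // !(dotDr, dotZr) fp // fq // fU // fU' // rmorphM /=.
  by ring.
set w := (c * ep i)%:~R => Ew.
have : c * ep i = 0 by apply: (@int_near0 R); lra.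
move=> /(congr1 (fun z => z * ep i)); rewrite mul0r -mulrA ep_unit // mulr1 => c0.
exists a, b, (a * al i + b * be i - strip_index i u + strip_index i v).
move/eqP: uv; rewrite c0 scale0r addr0 pS // qS // /slide.
move=> /eqP/matrixP uv; apply/matrixP => k l; have := uv k l.
rewrite !mxE !(rmorphD, rmorphN, rmorphM) /= => {}uv.
by apply/eqP; rewrite -subr_eq0; move/eqP: uv; rewrite -subr_eq0 => /eqP <-; apply/eqP; ring.
Qed.

(** A multiple of U i.+1, which belongs to the next lattice, brings w into the
strip, where sliding does nothing. *)
Lemma slide_surjective i w : (i < M)%N ->
  exists2 v, chain_lattice i.+1 (slide i v - w) & exists c : int, v = w + c%:~R *: U i.+1.
Proof.
move=> iM; pose c := - (ep i * strip_index i w); pose v := w + c%:~R *: U i.+1.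
exists v; last by exists c.
have epR : (ep i)%:~R * (ep i)%:~R = 1 :> R by rewrite -rmorphM ep_unit.
have sv : strip_index i v = 0.
  apply/strip_indexP; have /strip_indexP := erefl (strip_index i w).
  rewrite /v dotDr dotZr fU' // /c rmorphN rmorphM /= mulr0 addr0.
  set s := (strip_index i w)%:~R; set e := (ep i)%:~R in epR *.
  have -> : - (e * s) * (2 * e) = - (2 * s) * (e * e) by ring.
  by rewrite epR mulr1 => /andP[h1 h2]; apply/andP; split; lra.
exists 0, 0, c; rewrite /slide sv !scale0r !addr0 add0r /v.
by rewrite addrC addKr.
Qed.

Lemma slides_equivariant i u v : (i <= M)%N ->
  chain_lattice 0 (u - v) -> chain_lattice i (slides i u - slides i v).
Proof.
elim: i => // i IHi iM uv; apply: slide_equivariant => //.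
by apply: IHi => //; exact: ltnW.
Qed.

Lemma slides_reflects i u v : (i <= M)%N ->
  chain_lattice i (slides i u - slides i v) -> chain_lattice 0 (u - v).
Proof.
elim: i => // i IHi iM uv; apply: IHi; first exact: ltnW.
exact: slide_reflects uv.
Qed.

Lemma chain_lattice_trans i u v w : chain_lattice i (u - v) ->
  chain_lattice i (v - w) -> chain_lattice i (u - w).
Proof.
move=> [a [b [c uv]]] [a' [b' [c' vw]]]; exists (a + a'), (b + b'), (c + c').
have -> : u - w = (u - v) + (v - w) by rewrite addrA subrK.
by rewrite uv vw; apply/matrixP => k l; rewrite !mxE !rmorphD /=; ring.
Qed.

Lemma slides_surjective i w : (i <= M)%N ->
  exists v, chain_lattice i (slides i v - w).
Proof.
elim: i w => [|i IHi] w iM.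
  by exists w; exists 0, 0, 0; rewrite /= subrr !scale0r !addr0.
have [v' Hv' _] := slide_surjective w iM.
have [v Hv] := IHi v' (ltnW iM); exists v.
exact: chain_lattice_trans (slide_equivariant iM Hv) Hv'.
Qed.

End StripChain.

(** * The strips of the Penrose kite *)

Section Data.
Local Open Scope Z_scope.
Let z a b : zphi := (a, b).

(** The forms f_0, ..., f_7 in the coordinates (X, Y, Z) of the torus, followed by
the three coordinate forms.  On the leaf of Theta, f_i and f_(i+4) agree up to a
constant; off the leaf f_(i+4) has to differ, as it belongs to another lattice. *)
Definition strip_forms : seq (seq zphi) :=
  [:: [:: z 0 0; z 1 0; z 0 0];
      [:: z 1 0; z 2 (-1); z 0 0];
      [:: z 0 1; z (-2) 1; z 0 0];
      [:: z 0 1; z (-1) 0; z 0 0];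
      [:: z 0 1; z (-1) 0; z (-1) 0];
      [:: z 0 1; z (-2) 1; z (-2) 1];
      [:: z 1 0; z 2 (-1); z 2 (-1)];
      [:: z 0 0; z 1 0; z 1 0];
      [:: z 1 0; z 0 0; z 0 0];
      [:: z 0 0; z 1 0; z 0 0];
      [:: z 0 0; z 0 0; z 1 0]].

(** The images u_i of the vectors V_i under the linear part of Theta. *)
Definition slide_vectors : seq (seq zphi) :=
  [:: [:: z 0 0; z (-2) 0; z 4 0];
      [:: z 2 (-2); z (-2) 0; z 2 0];
      [:: z (-8) 4; z 2 (-2); z 0 0];
      [:: z 2 (-2); z 0 0; z (-2) 0]].

Definition strip_offsets : seq zphi :=
  [:: z 0 0; z 1 (-1); z (-2) 1; z (-1) 1; z (-1) 1; z (-2) 1; z 1 (-1); z 0 0].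

(** Bases of the lattices, found by following (2,0,0) and (0,0,2) through the
eight slides: each vector moves along u_i into the kernel of f_i. *)
Definition lattice_p : seq (seq zphi) :=
  [:: [:: z 2 0; z 0 0; z 0 0];
      [:: z 2 0; z 0 0; z 0 0];
      [:: z 4 (-2); z (-2) 0; z 2 0];
      [:: z (-4) 2; z 0 (-2); z 2 0];
      [:: z (-2) 0; z 0 (-2); z 0 0];
      [:: z (-2) 0; z 0 (-2); z 0 0];
      [:: z (-4) 2; z 2 (-2); z (-2) 0];
      [:: z 4 (-2); z 0 0; z (-2) 0];
      [:: z 2 0; z 0 0; z 0 0]].

Definition lattice_q : seq (seq zphi) :=
  nseq 5 [:: z 0 0; z 0 0; z 2 0] ++ nseq 4 [:: z 0 0; z 2 0; z (-2) 0].

Definition coef_p : seq Z := [:: 0; 1; 1; 1; 0; -1; -1; -1].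
Definition coef_q : seq Z := [:: 0; 0; 0; 0; -1; 0; 0; 0].
Definition coef_next : seq Z := [:: -1; -1; -1; 1; -1; -1; -1; 1].

(** All the forms are positive on this vector, and so are their horizontal
parts on its projection. *)
Definition generic_direction : seq zphi := [:: z 4 0; z 4 0; z 1 0].

End Data.

Definition zform i := nth [::] strip_forms i.
Definition zvec i := nth [::] slide_vectors (i %% 4).
Definition zoff i := nth (zcst 0) strip_offsets i.

Definition chain_check (i : nat) : bool :=
  let P := nth [::] lattice_p in let Q := nth [::] lattice_q in
  let a := nth Z0 coef_p i in let b := nth Z0 coef_q i in
  let e := nth Z0 coef_next i in
  let step (S : nat -> seq zphi) c := all (fun l =>
    zeq (nth (zcst 0) (S i.+1) l)
        (zadd (nth (zcst 0) (S i) l) (zmul (zcst c) (nth (zcst 0) (zvec i) l)))) (iota 0 3) in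
  [&& zeq (zdot 3 (zform i) (zvec i)) (zcst (-2)),
      zeq (zdot 3 (zform i) (P i)) (zcst (2 * a)%Zc),
      zeq (zdot 3 (zform i) (Q i)) (zcst (2 * b)%Zc),
      zeq (zdot 3 (zform i) (zvec i.+1)) (zcst (2 * e)%Zc),
      Z.eqb (e * e)%Zc 1, step P a & step Q b].

Lemma chain_checkT : all chain_check (iota 0 8).
Proof. by vm_compute. Qed.

Lemma generic_direction3 :
  all (fun i => zpos (zdot 3 (zform i) generic_direction)) (iota 0 11).
Proof. by vm_compute. Qed.

Lemma generic_direction2 :
  all (fun i => zpos (zdot 2 (zform i) generic_direction)) (iota 0 10).
Proof. by vm_compute. Qed.

(** The determinant of any three of the forms is zero or a unit of Z[phi]. *)
Lemma unit_minors3 : all (fun i => all (fun j => all (fun k =>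
  zunit_or_zero (zdet3 (zform i) (zform j) (zform k)))
  (iota 0 11)) (iota 0 11)) (iota 0 11).
Proof. by vm_compute. Qed.

(** The horizontal parts of the forms have the same property; the vertical
coordinate form, whose horizontal part vanishes, is left out. *)
Lemma unit_minors2 : all (fun i => all (fun j =>
  zunit_or_zero (zdet2 (zform i) (zform j))) (iota 0 10)) (iota 0 10).
Proof. by vm_compute. Qed.

Section Chain.
Variable R : realType.
Local Notation V := 'rV[R]_3.
Local Notation T := (torus R 3).

Lemma zr_consts : (zr R 0 = 0) * (zr R 1 = 1) * (zr R 2 = 2) * (zr R 4 = 4)
  * (zr R (-1) = -1) * (zr R (-2) = -2) * (zr R (-8) = -8).
Proof. by do !split. Qed.

Definition form3 i : V := zrow R 3 (zform i).
Definition vec3 i : V := zrow R 3 (zvec i).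
Definition offset i : R := zval R (zoff i).
Local Notation P := (fun i => zrow R 3 (nth [::] lattice_p i)).
Local Notation Q := (fun i => zrow R 3 (nth [::] lattice_q i)).
Definition coef (s : seq Z) i : int := int_of_Z (nth Z0 s i).
Local Notation lattice := (chain_lattice vec3 P Q).

Lemma all_iota m (a : pred nat) i : all a (iota 0 m) -> (i < m)%N -> a i.
Proof. by move=> /allP H im; apply: H; rewrite mem_iota. Qed.

Lemma zr2M a : zr R (2 * a)%Zc = 2 * (int_of_Z a)%:~R.
Proof. by rewrite zrM. Qed.

Lemma zrow_step (s t u : seq zphi) (c : Z) :
  all (fun l => zeq (nth (zcst 0) t l)
     (zadd (nth (zcst 0) s l) (zmul (zcst c) (nth (zcst 0) u l)))) (iota 0 3) ->
  zrow R 3 t = zrow R 3 s + (int_of_Z c)%:~R *: zrow R 3 u.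
Proof.
move=> H; apply/matrixP => i j; rewrite !mxE.
by rewrite (zvalE R (all_iota H (ltn_ord j))) zvalD zvalM zval_cst.
Qed.

Section Facts.
Variables (i : nat) (i8 : (i < 8)%N).

Let chk := all_iota chain_checkT i8.

Lemma form_vec : dot (form3 i) (vec3 i) = -2.
Proof. by have /and5P[/(zvalE R) E _ _ _ _] := chk; rewrite dot_zrow E zval_cst. Qed.
Lemma form_p : dot (form3 i) (P i) = 2 * (coef coef_p i)%:~R.
Proof. by have /and5P[_ /(zvalE R) E _ _ _] := chk; rewrite dot_zrow E zval_cst zr2M. Qed.
Lemma form_q : dot (form3 i) (Q i) = 2 * (coef coef_q i)%:~R.
Proof. by have /and5P[_ _ /(zvalE R) E _ _] := chk; rewrite dot_zrow E zval_cst zr2M. Qed.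
Lemma form_next : dot (form3 i) (vec3 i.+1) = 2 * (coef coef_next i)%:~R.
Proof. by have /and5P[_ _ _ /(zvalE R) E _] := chk; rewrite dot_zrow E zval_cst zr2M. Qed.
Lemma coef_unit : coef coef_next i * coef coef_next i = 1.
Proof. by have /and5P[_ _ _ _ /and3P[E _ _]] := chk; rewrite /coef; lia. Qed.
Lemma p_next : P i.+1 = P i + (coef coef_p i)%:~R *: vec3 i.
Proof. by have /and5P[_ _ _ _ /and3P[_ E _]] := chk; exact: zrow_step. Qed.
Lemma q_next : Q i.+1 = Q i + (coef coef_q i)%:~R *: vec3 i.
Proof. by have /and5P[_ _ _ _ /and3P[_ _ E]] := chk; exact: zrow_step. Qed.

End Facts.

Lemma rowP3 (u v : V) : u 0 0 = v 0 0 -> u 0 1 = v 0 1 -> u 0 2 = v 0 2 -> u = v.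
Proof.
move=> h0 h1 h2; apply/rowP => -[[|[|[|//]]] h].
- by have -> : Ordinal h = 0 by apply/val_inj.
- by have -> : Ordinal h = 1 by apply/val_inj.
- by have -> : Ordinal h = 2 by apply/val_inj.
Qed.

Lemma lattice0E (v : V) : lattice 0%N v <-> v \in @even_lattice R 3.
Proof.
split => [[a [b [c ->]]]|/even_latticeP H].
  apply/even_latticeP => -[[|[|[|//]]] h]; rewrite !mxE /= /zval /= ?zr_consts.
  - by exists a; ring.
  - by exists (- c); rewrite rmorphN; ring.
  - by exists (b + 2 * c); rewrite rmorphD rmorphM /=; ring.
have [x xE] := H 0; have [y yE] := H 1; have [t tE] := H 2.
exists x, (t + 2 * y), (- y).
by apply: rowP3; rewrite ?xE ?yE ?tE !mxE /= /zval /= !(rmorphD, rmorphN, rmorphM) /= ?zr_consts; ring.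
Qed.

Lemma lattice8E (v : V) : lattice 8 v <-> v \in @even_lattice R 3.
Proof.
split => [[a [b [c ->]]]|/even_latticeP H].
  apply/even_latticeP => -[[|[|[|//]]] h]; rewrite !mxE /= /zval /= ?zr_consts.
  - by exists a; ring.
  - by exists (b - c); rewrite rmorphB /=; ring.
  - by exists (- b + 2 * c); rewrite !(rmorphD, rmorphN, rmorphM) /= ?zr_consts; ring.
have [x xE] := H 0; have [y yE] := H 1; have [t tE] := H 2.
exists x, (2 * y + t), (y + t).
by apply: rowP3; rewrite ?xE ?yE ?tE !mxE /= /zval /= !(rmorphD, rmorphN, rmorphM) /= ?zr_consts; ring.
Qed.

Local Notation G := (slides form3 vec3 offset 8).

Lemma G_equivariant u v : u - v \in @even_lattice R 3 -> G u - G v \in @even_lattice R 3.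
Proof.
move=> /lattice0E uv; apply/lattice8E.
exact: (slides_equivariant offset form_vec form_p form_q p_next q_next (leqnn 8) uv).
Qed.

Lemma G_reflects u v : G u - G v \in @even_lattice R 3 -> u - v \in @even_lattice R 3.
Proof.
move=> /lattice8E uv; apply/lattice0E.
exact: (slides_reflects form_vec form_p form_q p_next q_next form_next coef_unit (leqnn 8) uv).
Qed.

Lemma G_surjective w : exists v, G v - w \in @even_lattice R 3.
Proof.
have [v Hv] := slides_surjective offset form_vec form_p form_q p_next q_next form_next coef_unit w (leqnn 8).
by exists v; apply/lattice8E.
Qed.

(** The third coordinates of the u_i are even. *)
Lemma slides_height i v : exists m : int, slides form3 vec3 offset i v 0 2 = v 0 2 + 2 * m%:~R.
Proof.
elim: i => [|i [m IHi]]; first by exists 0; rewrite mulr0 addr0.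
have [m' Hm'] : exists m' : int, vec3 i 0 2 = 2 * m'%:~R.
  have : (i %% 4 < 4)%N by rewrite ltn_mod.
  rewrite /vec3 /zvec mxE; move: (i %% 4)%N => [|[|[|[|//]]]] _ /=.
  - by exists 2; rewrite /zval /= ?zr_consts; ring.
  - by exists 1; rewrite /zval /= ?zr_consts; ring.
  - by exists 0; rewrite /zval /= ?zr_consts; ring.
  - by exists (-1); rewrite /zval /= ?zr_consts; ring.
rewrite /= /slide mxE [X in _ + X]mxE IHi Hm'; set s := strip_index _ _ _ _.
by exists (m + s * m'); rewrite rmorphD rmorphM /=; ring.
Qed.

Definition hatPsi (t : T) : T := \pi_T (G (repr t)).

Lemma hatPsiE v : hatPsi (\pi_T v) = \pi_T (G v).
Proof.
apply/torus_piE/G_equivariant/torus_piE; exact: reprK.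
Qed.

Lemma hatPsi_inj : injective hatPsi.
Proof.
move=> t u; have [v ->] := torus_repr t; have [w ->] := torus_repr u.
by rewrite !hatPsiE => /torus_piE/G_reflects/torus_piE.
Qed.

Lemma hatPsi_surj t : exists t', t = hatPsi t'.
Proof.
have [w ->] := torus_repr t; have [v Hv] := G_surjective w.
by exists (\pi_T v); rewrite hatPsiE; apply/esym/torus_piE.
Qed.

End Chain.

(** * Cells, slices and the fibered exchange map *)

Section Heights.
Variable R : realType.
Implicit Types (v w : 'rV[R]_2) (x y : 'rV[R]_3).

Lemma ord3_ind (P : 'I_3 -> Prop) :
  P 2 -> (forall l : 'I_2, P (lshift 1 l)) -> forall l, P l.
Proof.
move=> P2 Pl l; case: (@split_ordP 2 1 l) => j ->; first exact: Pl.
by rewrite (_ : rshift 2 j = 2) //; apply/val_inj; rewrite ord1.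
Qed.

Lemma at_height_l (h : R) v (l : 'I_2) : at_height h v 0 (lshift 1 l) = v 0 l.
Proof. exact: row_mxEl. Qed.

Lemma at_height2 (h : R) v : at_height h v 0 2 = h.
Proof.
have E : row_mx v (const_mx h : 'rV[R]_1) 0 (rshift 2 0) = h by rewrite row_mxEr mxE.
by rewrite -[RHS]E; congr (row_mx _ _ _ _); apply/val_inj.
Qed.

Lemma horizontal_at_height (h : R) v : horizontal_part (at_height h v) = v.
Proof. exact: row_mxKl. Qed.

Lemma horizontal_partB x y :
  horizontal_part (x - y) = horizontal_part x - horizontal_part y.
Proof. exact: raddfB. Qed.

Lemma horizontal_partD x y :
  horizontal_part (x + y) = horizontal_part x + horizontal_part y.
Proof. exact: raddfD. Qed.

Lemma heightB x y : (x - y) 0 2 = x 0 2 - y 0 2.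
Proof. by rewrite !mxE. Qed.

Lemma height_diff x y x' y' (h : R) (m m' : int) :
  x 0 2 = x' 0 2 + 2 * m%:~R -> y 0 2 = y' 0 2 + 2 * m'%:~R ->
  x' 0 2 = h -> y' 0 2 = h -> exists k : int, (x - y) 0 2 = 2 * k%:~R.
Proof.
by move=> xE yE xh yh; exists (m - m'); rewrite heightB xE yE xh yh rmorphB /=; ring.
Qed.

Lemma even_lattice3 x : x \in @even_lattice R 3 <->
  horizontal_part x \in @even_lattice R 2 /\ exists m : int, x 0 2 = 2 * m%:~R.
Proof.
split=> [/even_latticeP H|[/even_latticeP H [m Hm]]].
  split; last exact: H.
  by apply/even_latticeP => l; rewrite mxE; exact: H.
apply/even_latticeP; apply: ord3_ind => [|l]; first by exists m.
by have [a Ha] := H l; exists a; rewrite -Ha mxE.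
Qed.

Lemma dot_at_height (s : seq zphi) (h : R) v :
  dot (zrow R 3 s) (at_height h v) = dot (zrow R 2 s) v + zrow R 3 s 0 2 * h.
Proof.
rewrite /dot (@big_split_ord _ _ _ 2 1) /= big_ord1 (_ : rshift 2 0 = 2); last exact/val_inj.
by rewrite at_height2; congr (_ + _); apply: eq_bigr => l _; rewrite at_height_l !mxE.
Qed.

End Heights.

Section Assembly.
Variable R : realType.
Local Notation form := (form3 R).
Local Notation vec := (vec3 R).
Local Notation off := (offset R).
Local Notation G := (slides form vec off 8).

Definition unit_box n : set 'rV[R]_n := [set v | forall l, 0 <= v 0 l < 2].

Lemma unit_box_repr n (t : torus R n) : exists2 v, unit_box v & t = \pi_(torus R n) v.
Proof.
have [w ->] := torus_repr t.
pose m : 'rV[R]_n := \row_l (2 * (- Num.floor (w 0 l / 2))%:~R).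
exists (w + m) => [l|]; last first.
  apply/esym/torus_piD/even_latticeP => l.
  by exists (- Num.floor (w 0 l / 2)); rewrite mxE.
rewrite !mxE; have := floor_itv (w 0 l / 2); rewrite ler_pdivlMr // ltr_pdivrMr //.
by rewrite !rmorphD rmorphN /= => /andP[h1 h2]; apply/andP; split; lra.
Qed.

Variable N : nat.
Hypothesis N_bound : forall v i, unit_box v -> (i < 8)%N ->
  `|strip_index form off i (slides form vec off i v)|%:~R <= N%:R :> R.

Local Notation K := {ffun 'I_8 -> 'I_(2 * N).+1}.

(* Values in 'I_(2 * N).+1 are shifted by N so as to represent [-N, N]. *)
Definition itinerary (k : K) (j : nat) : int :=
  if insub j is Some o then (k o)%:Z - N%:Z else 0.

Lemma itineraryE k (o : 'I_8) : itinerary k o = (k o)%:Z - N%:Z.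
Proof. by rewrite /itinerary valK. Qed.

(** The i-th condition on an itinerary bears on the point reached after i slides,
which is a fixed translate of v: it is a slab condition on v itself. *)
Definition lower (k : K) (j : nat) : R :=
  if (j < 8)%N then
    off j + 2 * (itinerary k j)%:~R - dot (form j) (itinerary_shift vec (itinerary k) j)
  else 0.

Definition upper (k : K) (j : nat) : R := lower k j + 2.

Definition total_shift (k : K) : 'rV[R]_3 := itinerary_shift vec (itinerary k) 8.

Lemma in_strip k (i : nat) v : (i < 8)%N ->
  (forall j, (j < i)%N -> strip_index form off j (slides form vec off j v) = itinerary k j) ->
  (lower k i <= dot (form i) v < upper k i <->
   strip_index form off i (slides form vec off i v) = itinerary k i).
Proof.
move=> i8 /slides_itinerary ->; rewrite -strip_indexP dotDr /lower /upper /lower i8.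
by split=> /andP[h1 h2]; apply/andP; split; lra.
Qed.

Lemma box_form n (l : 'I_n) : (n <= 3)%N -> zrow R n (zform (8 + l)) = delta_mx 0 l.
Proof.
move=> n3; apply/rowP => j; rewrite !mxE /=.
case: l => l hl; case: j => j hj; rewrite -(inj_eq val_inj) /=.
have l3 := leq_trans hl n3; have j3 := leq_trans hj n3.
case: l l3 {hl} => [|[|[|//]]] _; case: j j3 {hj} => [|[|[|//]]] _;
  by rewrite /zform /= /zval /= ?zr_consts; ring.
Qed.

Lemma dot_form_box n (l : 'I_n) (v : 'rV[R]_n) : (n <= 3)%N ->
  dot (zrow R n (zform (8 + l))) v = v 0 l.
Proof. by move=> n3; rewrite box_form // dot_delta. Qed.

Lemma half_open_cellP k v :
  (forall j : 'I_11, lower k j <= dot (form j) v < upper k j) <->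
  unit_box v /\ forall i, (i < 8)%N ->
    strip_index form off i (slides form vec off i v) = itinerary k i.
Proof.
split=> [H|[bv H] j].
  split=> [l|].
    have l11 : (8 + l < 11)%N by rewrite ltn_add2l.
    by have := H (Ordinal l11); rewrite /upper /lower /= dot_form_box // add0r.
  elim/ltn_ind => i IHi i8; apply/in_strip => //.
    by move=> j ji; apply: IHi => //; exact: ltn_trans i8.
  by have i11 : (i < 11)%N := leq_trans i8 (isT : (8 <= 11)%N); exact: (H (Ordinal i11)).
case: (ltnP j 8) => j8.
  by apply/in_strip => // [i ij|]; apply: H => //; exact: ltn_trans j8.
have jl : (j - 8 < 3)%N by rewrite ltn_subLR.
have := bv (Ordinal jl); rewrite -(dot_form_box (Ordinal jl) v) //= subnKC //.
by rewrite /upper /lower ltnNge j8 add0r.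
Qed.

Lemma itinerary_inj k k' :
  (forall i, (i < 8)%N -> itinerary k i = itinerary k' i) -> k = k'.
Proof.
move=> H; apply/ffunP => o; have := H o (ltn_ord o); rewrite !itineraryE => E.
by apply/val_inj => /=; lia.
Qed.

Lemma box_itinerary v : unit_box v -> exists k : K, forall i, (i < 8)%N ->
  strip_index form off i (slides form vec off i v) = itinerary k i.
Proof.
move=> bv.
pose s i := strip_index form off i (slides form vec off i v).
exists [ffun o : 'I_8 => inord (absz (s o + N%:Z))] => i i8.
have := N_bound bv i8; rewrite -/(s i) (pmulrn 1 N) ler_int => sN.
have := itineraryE [ffun o : 'I_8 => inord (absz (s o + N%:Z))] (Ordinal i8).
rewrite /= => ->; rewrite ffunE inordK /=; lia.
Qed.

Lemma lower_golden k j : lower k j \in @goldenp R.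
Proof.
rewrite /lower; case: ifP => _; last exact: rpred0.
have g n s i : zrow R n s 0 i \in @goldenp R by apply/goldenP; exact: zrow_golden.
apply: rpredB.
  apply: rpredD; first by apply/goldenP; exact: zval_golden.
  by apply: rpredM; rewrite ?rpred_nat ?rpred_int.
rewrite /dot rpred_sum // => i _; apply: rpredM; first exact: g.
rewrite /itinerary_shift summxE rpred_sum // => l _.
by rewrite mxE; apply: rpredM; [exact: rpred_int|exact: g].
Qed.

Lemma total_shift_golden k : golden_vector (total_shift k).
Proof.
move=> i; apply/goldenP; rewrite summxE rpred_sum // => l _.
by rewrite mxE; apply: rpredM; [exact: rpred_int|apply/goldenP; exact: zrow_golden].
Qed.

Lemma upper_golden k j : upper k j \in @goldenp R.
Proof. by rewrite rpredD ?lower_golden ?rpred_nat. Qed.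

Lemma det3_unit (f : 'I_3 -> 'I_11) :
  let D := \det (\matrix_(i, l) form (f i) 0 l) in D != 0 -> Zphi D^-1.
Proof.
rewrite /= det_zrow3; apply: zunit_or_zeroP.
by have := all_iota (all_iota (all_iota unit_minors3 (ltn_ord (f 0))) (ltn_ord (f (lift 0 0))))
   (ltn_ord (f (lift 0 (lift 0 0)))).
Qed.

Lemma exchange3 : exists E : polytope_exchange R 3,
  [/\ golden E, E = @hatPsi R :> (torus R 3 -> torus R 3),
      exchange_domain E = \bigcup_k ((\pi_(torus R 3) : _ -> _) @`
         open_cell (fun j : 'I_11 => form j) lower upper k),
      forall i, exists k, [/\ open_cell (fun j : 'I_11 => form j) lower upper k !=set0,
         @source _ _ E i = cell (fun j : 'I_11 => form j) lower upper k &
         @Defs.shift _ _ E i = total_shift k] &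
      forall k, open_cell (fun j : 'I_11 => form j) lower upper k !=set0 -> exists i,
         @source _ _ E i = cell (fun j : 'I_11 => form j) lower upper k /\
         @Defs.shift _ _ E i = total_shift k].
Proof.
apply: (@exchange_of_bijection R 2 'I_11 K (fun j => form j) (zrow R 3 generic_direction)
  lower upper total_shift (@hatPsi R) (fun=> 0)).
- by move=> j; rewrite dot_zrow; apply/zposP/(all_iota generic_direction3).
- move=> k i; have i11 : (8 + i < 11)%N by rewrite ltn_add2l.
  by exists (Ordinal i11); split => //=; exact: box_form.
- move=> k k' v /half_open_cellP[_ kv] /half_open_cellP[_ kv'].
  by apply: itinerary_inj => i i8; rewrite -kv // -kv'.
- move=> t; have [v bv ->] := unit_box_repr t; have [k kv] := box_itinerary bv.
  by exists k, v; split => //; apply/half_open_cellP.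
- exact: hatPsi_inj.
- exact: hatPsi_surj.
- move=> k v /half_open_cellP[_ kv].
  by rewrite hatPsiE (slides_itinerary (k := itinerary k)).
- by move=> j; exact: zrow_golden.
- by move=> k j; split; apply/goldenP; [exact: lower_golden|exact: upper_golden].
- exact: total_shift_golden.
- exact: det3_unit.
Qed.


(** The slice of the cells at height h.  At heights where cells have horizontal
faces the half-open convention selects the cells above h. *)
Section Slice.
Variable h : R.
Hypothesis h_box : 0 <= h < 2.
Local Notation T2 := (torus R 2).

Definition slice_lower (k : K) (j : nat) : R := lower k j - form j 0 2 * h.
Definition slice_upper (k : K) (j : nat) : R := upper k j - form j 0 2 * h.
Definition slice_form (j : 'I_10) : 'rV[R]_2 := zrow R 2 (zform j).

Lemma slice_cellP k v : half_open_cell slice_form slice_lower slice_upper k v <->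
  half_open_cell (fun j : 'I_11 => form j) lower upper k (at_height h v).
Proof.
split=> H j.
  case: (ltnP j 10) => j10.
    have /andP[h1 h2] := H (Ordinal j10).
    rewrite dot_at_height; move: h1 h2; rewrite /slice_lower /slice_upper /slice_form /=.
    by move=> h1 h2; apply/andP; split; lra.
  have j11 := ltn_ord j; have j2 : nat_of_ord j = (8 + 2)%N by lia.
  rewrite j2 (dot_form_box 2 _ (leqnn 3)) at_height2.
  by rewrite /upper /lower /= add0r.
have j11 : (j < 11)%N := leq_trans (ltn_ord j) (isT : (10 <= 11)%N).
have := H (Ordinal j11); rewrite dot_at_height /slice_lower /slice_upper /slice_form /=.
by move=> /andP[h1 h2]; apply/andP; split; lra.
Qed.

Lemma slice_closed_cell k : cell slice_form slice_lower slice_upper k =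
  [set v | cell (fun j : 'I_11 => form j) lower upper k (at_height h v)].
Proof.
have /andP[h0 h2] := h_box.
apply/seteqP; split=> v H j.
  case: (ltnP j 10) => j10.
    have /andP[h1 h3] := H (Ordinal j10).
    rewrite dot_at_height; move: h1 h3; rewrite /slice_lower /slice_upper /slice_form /=.
    by move=> h1 h3; apply/andP; split; lra.
  have j11 := ltn_ord j; have j2 : nat_of_ord j = (8 + 2)%N by lia.
  rewrite j2 (dot_form_box 2 _ (leqnn 3)) at_height2.
  by rewrite /upper /lower /= add0r h0 ltW.
have j11 : (j < 11)%N := leq_trans (ltn_ord j) (isT : (10 <= 11)%N).
have := H (Ordinal j11); rewrite dot_at_height /slice_lower /slice_upper /slice_form /=.
by move=> /andP[h1 h3]; apply/andP; split; lra.
Qed.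

Definition slice_map (t : T2) : T2 :=
  \pi_T2 (horizontal_part (G (at_height h (repr t)))).


Lemma at_height_even v w : v - w \in @even_lattice R 2 <->
  at_height h v - at_height h w \in @even_lattice R 3.
Proof.
rewrite even_lattice3 horizontal_partB !horizontal_at_height; split=> [?|[]//].
by split=> //; exists 0; rewrite heightB !at_height2 subrr mulr0.
Qed.

Lemma slice_mapE v : slice_map (\pi_T2 v) = \pi_T2 (horizontal_part (G (at_height h v))).
Proof.
apply/torus_piE; rewrite -horizontal_partB.
have /even_lattice3[] // : G (at_height h (repr (\pi_T2 v))) - G (at_height h v)
  \in @even_lattice R 3.
by apply/G_equivariant/at_height_even/torus_piE; exact: reprK.
Qed.

Lemma slice_map_inj : injective slice_map.
Proof.
move=> t u; have [v ->] := torus_repr t; have [w ->] := torus_repr u.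
rewrite !slice_mapE => /torus_piE vw; apply/torus_piE/at_height_even/G_reflects.
apply/even_lattice3; rewrite horizontal_partB; split=> //.
have [m Hm] := slides_height 8 (at_height h v).
have [m' Hm'] := slides_height 8 (at_height h w).
exact: height_diff Hm Hm' (at_height2 _ _) (at_height2 _ _).
Qed.

Lemma slice_map_surj t : exists t', t = slice_map t'.
Proof.
have [w ->] := torus_repr t; have [v Hv] := G_surjective (at_height h w).
pose u := horizontal_part v; exists (\pi_T2 u); rewrite slice_mapE.
have [m Hm] := slides_height 8 v.
have vu : at_height h u - v \in @even_lattice R 3.
  apply/even_lattice3; rewrite horizontal_partB horizontal_at_height subrr rpred0.
  split=> //; have /even_lattice3[_ [m' Hm']] := Hv.
  exists (m - m'); move: Hm'; rewrite !heightB Hm !at_height2 rmorphB /=; lra.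
have /even_lattice3[+ _] : G (at_height h u) - at_height h w \in @even_lattice R 3.
  by have := rpredD (G_equivariant vu) Hv; rewrite addrA subrK.
by rewrite horizontal_partB horizontal_at_height => /torus_piE.
Qed.

Lemma det2_unit (f : 'I_2 -> 'I_10) :
  let D := \det (\matrix_(i, l) slice_form (f i) 0 l) in D != 0 -> Zphi D^-1.
Proof.
rewrite /= det_zrow2; apply: zunit_or_zeroP.
by have := all_iota (all_iota unit_minors2 (ltn_ord (f 0))) (ltn_ord (f (lift 0 0))).
Qed.

Hypothesis h_golden : h \in @goldenp R.

Lemma exchange2 : exists F : polytope_exchange R 2, golden F /\
  forall i, exists k, [/\ open_cell slice_form slice_lower slice_upper k !=set0,
    @source _ _ F i = cell slice_form slice_lower slice_upper k &
    @Defs.shift _ _ F i = horizontal_part (total_shift k)].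
Proof.
suff [F [gF _ _ FE _]] : exists F : polytope_exchange R 2,
  [/\ golden F, F = slice_map :> (T2 -> T2),
      exchange_domain F = \bigcup_k ((\pi_(torus R 2) : _ -> _) @`
         open_cell slice_form slice_lower slice_upper k),
      forall i, exists k, [/\ open_cell slice_form slice_lower slice_upper k !=set0,
         @source _ _ F i = cell slice_form slice_lower slice_upper k &
         @Defs.shift _ _ F i = horizontal_part (total_shift k)] &
      forall k, open_cell slice_form slice_lower slice_upper k !=set0 -> exists i,
         @source _ _ F i = cell slice_form slice_lower slice_upper k /\
         @Defs.shift _ _ F i = horizontal_part (total_shift k)].
  by exists F.
have gform (j : nat) : form j 0 2 * h \in @goldenp R.
  by apply: rpredM => //; apply/goldenP; exact: zrow_golden.
apply: (@exchange_of_bijection R 1 'I_10 K slice_form (zrow R 2 generic_direction)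
  slice_lower slice_upper (fun k => horizontal_part (total_shift k)) slice_map (fun=> 0)).
- by move=> j; rewrite dot_zrow; apply/zposP/(all_iota generic_direction2).
- move=> k i; have i10 : (8 + i < 10)%N by rewrite ltn_add2l.
  have i11 : (8 + i < 11)%N := leq_trans i10 (isT : (10 <= 11)%N).
  have form0 : form (8 + i) 0 2 = 0.
    have i3 : (i < 3)%N := leq_trans (ltn_ord i) (isT : (2 <= 3)%N).
    rewrite /form3 (box_form (Ordinal i3) (leqnn 3)) mxE /= -(inj_eq val_inj) /=.
    by case: i i3 {i10 i11} => -[|[|//]].
  exists (Ordinal i10); split; first exact: box_form.
    by rewrite /slice_lower form0 mul0r subr0.
  by rewrite /slice_upper form0 mul0r subr0.
- move=> k k' v /slice_cellP/half_open_cellP[_ kv] /slice_cellP/half_open_cellP[_ kv'].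
  by apply: itinerary_inj => i i8; rewrite -kv // -kv'.
- move=> t; have [v bv ->] := unit_box_repr t.
  have bhv : unit_box (at_height h v).
    by apply: ord3_ind => [|l]; rewrite ?at_height2 ?at_height_l.
  have [k kv] := box_itinerary bhv.
  by exists k, v; split => //; apply/slice_cellP/half_open_cellP.
- exact: slice_map_inj.
- exact: slice_map_surj.
- move=> k v /slice_cellP/half_open_cellP[_ kv].
  rewrite slice_mapE (slides_itinerary (k := itinerary k)) //.
  by rewrite horizontal_partD horizontal_at_height.
- by move=> j; exact: zrow_golden.
- by move=> k j; split; apply/goldenP; apply: rpredB => //;
    [exact: lower_golden|exact: upper_golden].
- by move=> k l; rewrite mxE; exact: total_shift_golden.
- exact: det2_unit.
Qed.

End Slice.
End Assembly.

Section FiberedExchange.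
Variable R : realType.
Local Notation form := (form3 R).
Local Notation vec := (vec3 R).
Local Notation off := (offset R).
Local Notation G := (slides form vec off 8).

(** For a point over the exchange domain, all strips are entered in their
interiors, even if it lies far away from the fundamental box: the values of f_i
along its itinerary are congruent modulo 2 to those of its representative in
the box. *)
Theorem fibered_exchange : exists E : polytope_exchange R 3, fibered_golden E /\
  forall u, exchange_domain E (\pi_(torus R 3) u) -> exists k : nat -> int,
    (forall i, (i < 8)%N ->
       off i + 2 * (k i)%:~R < dot (form i) (u + itinerary_shift vec k i)
         < off i + 2 * (k i)%:~R + 2) /\
    E (\pi_(torus R 3) u) = \pi_(torus R 3) (u + itinerary_shift vec k 8).
Proof.
have [|N HN] := @bounded_itinerary R 3 8 form vec off (@unit_box R 3) 2.
  by move=> v bv l; have /andP[h1 h2] := bv l; rewrite ger0_norm // ltW.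
have [E [gE EE Edom Esrc Eall]] := exchange3 HN.
exists E; split; first split=> //.
- move=> h _ [t [[v _ <-] _] <-]; rewrite EE hatPsiE.
  have [m Hm] := slides_height 8 (at_height h v); rewrite at_height2 in Hm.
  exists (horizontal_part (G (at_height h v))) => //; apply/torus_piE/even_lattice3.
  rewrite horizontal_partB horizontal_at_height subrr rpred0; split=> //.
  by exists (- m); rewrite heightB at_height2 Hm rmorphN /=; ring.
- move=> h gh; pose c := - Num.floor (h / 2); pose h' := h + 2 * c%:~R.
  have h'_box : 0 <= h' < 2.
    have := floor_itv (h / 2); rewrite ler_pdivlMr // ltr_pdivrMr // /h' /c.
    by rewrite !rmorphD rmorphN /= => /andP[h1 h2]; apply/andP; split; lra.
  have h'_golden : h' \in @goldenp R.
    by apply: rpredD; [apply/goldenP|apply: rpredM; rewrite ?rpred_nat ?rpred_int].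
  have [F [gF Fsrc]] := exchange2 HN h'_box h'_golden.
  exists F; split=> // i; have [k [[v kv] si shi]] := Fsrc i.
  have kv' := (slice_cellP h'_box k v).1 (open_slabsW kv).
  have d_pos (j : 'I_11) : 0 < dot (form j) (zrow R 3 generic_direction).
    by rewrite dot_zrow; apply/zposP/(all_iota generic_direction3).
  have [j [sj shj]] := Eall k (half_open_slabs_step d_pos kv').
  by exists j, c; rewrite si sj shi shj; split=> //; exact: slice_closed_cell.
- move=> u; rewrite Edom => -[k _ [v kv /torus_piE vu]].
  pose s i := strip_index form off i (slides form vec off i u).
  exists s; split; last first.
    by rewrite EE hatPsiE (slides_itinerary (k := s)).
  move=> i i8.
  have uE := @slides_itinerary R 3 form vec off s i u (fun _ _ => erefl).
  have vu0 : chain_lattice vec (fun i => zrow R 3 (nth [::] lattice_p i))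
    (fun i => zrow R 3 (nth [::] lattice_q i)) 0 (v - u) by apply/lattice0E.
  have [a [b [c vuE]]] := slides_equivariant off (@form_vec R) (@form_p R) (@form_q R)
    (@p_next R) (@q_next R) (ltnW i8) vu0.
  rewrite -uE; have /strip_indexP/andP[s1 s2] := erefl (s i).
  have /half_open_cellP[_ kE] := open_slabsW kv.
  have vE : slides form vec off i v = v + itinerary_shift vec (itinerary k) i.
    by apply: slides_itinerary => j ji; apply: kE; exact: ltn_trans i8.
  have i11 : (i < 11)%N := leq_trans i8 (isT : (8 <= 11)%N).
  have /andP[] := kv (Ordinal i11); rewrite /upper /lower /= i8 => v1 _.
  apply/andP; split=> //; rewrite lt_neqAle s1 andbT; apply/eqP => su.
  have Dv : dot (form i) (slides form vec off i v) =
      dot (form i) v + dot (form i) (itinerary_shift vec (itinerary k) i).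
    by rewrite vE dotDr.
  have /strip_indexP/andP[_ v2] := kE i i8.
  have : dot (form i) (slides form vec off i v) - dot (form i) (slides form vec off i u) =
      2 * (a * coef coef_p i + b * coef coef_q i - c)%:~R.
    rewrite -dotBr vuE !dotDr !dotZr form_p // form_q // form_vec //.
    by rewrite !(rmorphD, rmorphN, rmorphM) /=; ring.
  set m := _ - c => Em.
  pose e := m + s i - itinerary k i.
  have eE : e%:~R = m%:~R + (s i)%:~R - (itinerary k i)%:~R :> R.
    by rewrite rmorphB rmorphD.
  have e1 : (0 : R) < e%:~R by lra.
  have e0 : e = 0 by apply: (@int_near0 R); lra.
  by rewrite e0 ltxx in e1.
Qed.

End FiberedExchange.

(** * Fourier-Motzkin elimination *)

(** The constraint a x + b y + c >= 0 on a point (x, y) of the plane, or > 0 when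
strict is set. *)
Definition constraint : Type := (zphi * zphi * zphi * bool)%type.
Definition Con (a b c : zphi) (s : bool) : constraint := (a, b, c, s).
Definition cx (c : constraint) : zphi := c.1.1.1.
Definition cy (c : constraint) : zphi := c.1.1.2.
Definition cc (c : constraint) : zphi := c.1.2.
Definition strict (c : constraint) : bool := c.2.

Definition con_swap (c : constraint) := Con (cy c) (cx c) (cc c) (strict c).
Definition con_opp (c : constraint) :=
  Con (zopp (cx c)) (zopp (cy c)) (zopp (cc c)) (~~ strict c).
(* The combination that cancels the coefficients of x, positive in c and
negative in d. *)
Definition con_comb (c d : constraint) :=
  let a := cx c in let b := zopp (cx d) in
  Con (zcst 0) (zadd (zmul b (cy c)) (zmul a (cy d)))
    (zadd (zmul b (cc c)) (zmul a (cc d))) (strict c || strict d).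

Definition eliminate (cs : seq constraint) :=
  [seq c <- cs | zeq (cx c) (zcst 0)] ++
  [seq con_comb c d | c <- [seq c <- cs | zpos (cx c)],
                      d <- [seq d <- cs | zpos (zopp (cx d))]].

Definition con_absurd (c : constraint) :=
  [&& zeq (cx c) (zcst 0), zeq (cy c) (zcst 0) &
   zpos (zopp (cc c)) || strict c && zeq (cc c) (zcst 0)].

(** Eliminating x, then y, leaves constraints between constants. *)
Definition infeasible (cs : seq constraint) :=
  has con_absurd (eliminate [seq con_swap c | c <- eliminate cs]).

Definition entails (cs : seq constraint) (c : constraint) := infeasible (con_opp c :: cs).
Definition entails_all cs ds := all (entails cs) ds.

Section Soundness.
Variable R : realType.
Implicit Types p : R * R.
Notation ev := (zval R).

Definition lhs (c : constraint) p : R := ev (cx c) * p.1 + ev (cy c) * p.2 + ev (cc c).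
Definition sat p (c : constraint) : bool := if strict c then 0 < lhs c p else 0 <= lhs c p.

Lemma sat_opp p c : sat p (con_opp c) = ~~ sat p c.
Proof.
have -> : sat p (con_opp c) = if strict c then lhs c p <= 0 else lhs c p < 0.
  have E : lhs (con_opp c) p = - lhs c p by rewrite /lhs /= !zvalN; ring.
  by rewrite /sat E /=; case: (strict c) => /=; rewrite ?oppr_ge0 ?oppr_gt0.
by rewrite /sat; case: (strict c); rewrite -?ltNge -?leNgt.
Qed.

Lemma satW p c : sat p c -> 0 <= lhs c p.
Proof. by rewrite /sat; case: (strict c) => // /ltW. Qed.

Lemma sat_comb p c d : zpos (cx c) -> zpos (zopp (cx d)) ->
  sat p c -> sat p d -> sat p (con_comb c d).
Proof.
move=> /(zposP R) c0 /(zposP R) d0 sc sd.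
have E : lhs (con_comb c d) p = ev (zopp (cx d)) * lhs c p + ev (cx c) * lhs d p.
  by rewrite /lhs /= !zvalD !zvalM zvalN zval_cst (_ : zr R 0 = 0) //; ring.
have c1 := satW sc; have d1 := satW sd.
rewrite /sat E /=; move: sc sd; rewrite /sat.
have c0' := ltW c0; have d0' := ltW d0.
case: (strict c) => /= sc.
  by move=> _; apply: ltr_pwDl; [rewrite mulr_gt0|rewrite mulr_ge0].
case: (strict d) => /= sd.
  by apply: ltr_wpDl; [rewrite mulr_ge0|rewrite mulr_gt0].
by rewrite addr_ge0 // mulr_ge0.
Qed.

Lemma sat_eliminate p cs : all (sat p) cs -> all (sat p) (eliminate cs).
Proof.
move=> /allP H; apply/allP => c; rewrite mem_cat mem_filter => /orP[/andP[_ /H]//|].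
move=> /allpairsP[[c1 c2] /= [+ + ->]]; rewrite !mem_filter => /andP[p1 /H s1] /andP[p2 /H s2].
exact: sat_comb.
Qed.

Lemma infeasibleP p cs : infeasible cs -> ~~ all (sat p) cs.
Proof.
move=> /hasP[c cI cA]; apply/negP => /sat_eliminate H.
have : all (sat (p.2, p.1)) [seq con_swap c | c <- eliminate cs].
  apply/allP => _ /mapP[d dI ->]; move/allP: H => /(_ d dI).
  by rewrite /sat /lhs /= [X in X + _]addrC.
move=> /sat_eliminate/allP/(_ c cI); move: cA => /and3P[/(zvalE R) x0 /(zvalE R) y0].
rewrite /sat /lhs x0 y0 zval_cst (_ : zr R 0 = 0) // !mul0r !add0r.
move=> /orP[/(zposP R)|/andP[-> /(zvalE R) ->]]; last by rewrite zval_cst ltxx.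
by rewrite zvalN oppr_gt0 leNgt => c0; rewrite c0 ltNge ltW //; case: ifP.
Qed.

Lemma entailsP p cs c : entails cs c -> all (sat p) cs -> sat p c.
Proof.
by move=> /(infeasibleP p) /=; rewrite sat_opp negb_and negbK => /orP[//|/negP].
Qed.

Lemma entails_allP p cs ds : entails_all cs ds -> all (sat p) cs -> all (sat p) ds.
Proof. by move=> /allP H sp; apply/allP => d /H/entailsP; apply. Qed.

End Soundness.

(** * The combinatorics of half a turn *)

Definition zpoint := (zphi * zphi)%type.
Definition zsub (x y : zphi) := zadd x (zopp y).
Definition zscale (c : Z) (v : zpoint) : zpoint := (zmul (zcst c) v.1, zmul (zcst c) v.2).
Definition zplus (v w : zpoint) : zpoint := (zadd v.1 w.1, zadd v.2 w.2).

Section Data.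
Local Open Scope Z_scope.
Let z a b : zphi := (a, b).

(** The vertices A = (-1, 0), T = (0, 1), D = (0, -1) and E = (phi^-3, 0) of the kite,
with phi^-3 = 2 phi - 3. *)
Definition zvertices : seq zpoint :=
  [:: (z (-1) 0, z 0 0); (z 0 0, z 1 0); (z 0 0, z (-1) 0); (z (-3) 2, z 0 0)].
Definition zvertex i := nth (z 0 0, z 0 0) zvertices i.

(** The vectors V_i, continued with period 4. *)
Definition zmoves : seq zpoint :=
  [:: (z 0 0, z 4 0); (z (-2) 0, z 2 0); (z 4 (-4), z 0 0); (z (-2) 0, z (-2) 0)].
Definition zmove i := nth (z 0 0, z 0 0) zmoves (i %% 4).

Definition y_gt_min2 := Con (z 0 0) (z 1 0) (z 2 0) true.
Definition y_gt_2 := Con (z 0 0) (z 1 0) (z (-2) 0) true.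
Definition y_le_min2 := Con (z 0 0) (z (-1) 0) (z (-2) 0) false.
Definition y_le_2 := Con (z 0 0) (z (-1) 0) (z 2 0) false.
Definition y_ge_0 := Con (z 0 0) (z 1 0) (z 0 0) false.
Definition y_le_0 := Con (z 0 0) (z (-1) 0) (z 0 0) false.

(** The kite and the set B fill the space between the graphs x = |y| - 1 and
x = phi^-3 (1 - |y|), where phi^-3 = 2 phi - 3.  Right and left of them, the sign of y
separates two convex pieces. *)
Definition right_piece (up : bool) : seq constraint :=
  if up then [:: y_ge_0; y_le_2; Con (z 1 0) (z (-1) 0) (z 1 0) true;
                 Con (z 1 0) (z (-3) 2) (z 3 (-2)) true]
  else [:: y_le_0; y_gt_min2; Con (z 1 0) (z 1 0) (z 1 0) true;
           Con (z 1 0) (z 3 (-2)) (z 3 (-2)) true].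
Definition left_piece (up : bool) : seq constraint :=
  if up then [:: y_ge_0; y_le_2; Con (z (-1) 0) (z 1 0) (z (-1) 0) true;
                 Con (z (-1) 0) (z 3 (-2)) (z (-3) 2) true]
  else [:: y_le_0; y_gt_min2; Con (z (-1) 0) (z (-1) 0) (z (-1) 0) true;
           Con (z (-1) 0) (z (-3) 2) (z (-3) 2) true].

(** The conditions 0 <= 2 (f_i (Theta_lift p) - off_i) <= 4; the factor 2 clears
the denominators of Theta_lift. *)
Definition strip_pair (i : nat) : seq constraint :=
  let f := zform i in let e k := nth (zcst 0) f k in
  let a := zadd (zmul (z (-2) 2) (e 0%N)) (e 1%N) in
  let b := zadd (zopp (e 1%N)) (zmul (z 2 0) (e 2%N)) in
  let c := zadd (zadd (zmul (z 2 0) (e 0%N)) (e 1%N)) (zmul (z (-2) 0) (zoff i)) in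
  [:: Con a b c false; Con (zopp a) (zopp b) (zsub (z 4 0) c) false].
End Data.

(** Seen from the point at hand, w lies to the right of v. *)
Definition side (s : bool) (v w : zpoint) : constraint :=
  Con (zsub w.2 v.2) (zsub v.1 w.1) (zsub (zmul v.2 w.1) (zmul v.1 w.2)) s.

Definition cone (s : bool) i : seq constraint :=
  [seq side s (zvertex i) (zvertex j) | j <- iota 0 4 & j != i].

(** The pullback of c under the translation by v. *)
Definition translate (v : zpoint) (c : constraint) : constraint :=
  Con (cx c) (cy c) (zadd (cc c) (zadd (zmul (cx c) v.1) (zmul (cy c) v.2))) (strict c).
(** The pullback of c under the point reflection in v. *)
Definition reflect_con (v : zpoint) (c : constraint) : constraint :=
  Con (zopp (cx c)) (zopp (cy c))
    (zadd (cc c) (zmul (zcst 2) (zadd (zmul (cx c) v.1) (zmul (cy c) v.2)))) (strict c).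

(** The points p that the map reflects first in v, and then in w.  Reflections being
affine, these are given by linear constraints. *)
Definition region (vw : nat * nat) : seq constraint :=
  cone true vw.1 ++ [seq reflect_con (zvertex vw.1) c | c <- cone true vw.2].
Definition displacement (vw : nat * nat) : zpoint :=
  zscale 2 (zplus (zvertex vw.2) (zscale (-1) (zvertex vw.1))).
Definition regions : seq (nat * nat) := [seq (i, j) | i <- iota 0 4, j <- iota 0 4].

(** The itinerary of half a turn.  Each region met by an orbit comes with the
index s of the vector V_s along which it moves and with the sign of the
move.  In two small regions near the kite, the displacement of psi is a sum of
three moves along V_s, V_(s+1) and V_(s+2).  A last constraint on y, depending on
the stage, tells apart the two visits of a full turn to the same region. *)
Record turn_table := TurnTable {
  stages : seq ((nat * nat) * (nat * seq Z));
  bound : nat -> constraint;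
  origin : bool -> seq constraint;
  goal : bool -> seq constraint }.

(* Vertices are numbered A = 0, T = 1, D = 2, E = 3. *)
Definition right_half := TurnTable
  [:: ((2,1), (0, [:: 1%Zc])); ((2,0), (1, [:: 1%Zc])); ((3,0), (2, [:: 1%Zc]));
      ((1,0), (3, [:: 1%Zc])); ((1,2), (4, [:: (-1)%Zc]));
      ((3,2), (2, [:: 1%Zc; (-1)%Zc; (-1)%Zc]))]%N
  (fun s => if (s < 4)%N then y_gt_min2 else y_gt_2) right_piece left_piece.
Definition left_half := TurnTable
  [:: ((1,2), (0, [:: (-1)%Zc])); ((0,2), (1, [:: (-1)%Zc])); ((0,3), (2, [:: (-1)%Zc]));
      ((0,1), (3, [:: (-1)%Zc])); ((2,1), (4, [:: 1%Zc]));
      ((1,3), (0, [:: (-1)%Zc; 1%Zc; (-1)%Zc]))]%N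
  (fun s => if (s < 4)%N then y_le_2 else y_le_min2) left_piece right_piece.

Definition find_stage (h : turn_table) vw : option (nat * seq Z) :=
  if [seq e.2 | e <- stages h & e.1 == vw] is x :: _ then Some x else None.

Definition strips i j : seq constraint := flatten [seq strip_pair k | k <- iota i (j - i)].
Definition bools := [:: true; false].

Fixpoint move_sum i (s : seq Z) : zpoint :=
  if s is c :: s' then zplus (zscale c (zmove i)) (move_sum i.+1 s') else (zcst 0, zcst 0).
Definition zpeq (v w : zpoint) := zeq v.1 w.1 && zeq v.2 w.2.

Definition out_stage (x : nat * seq Z) := (x.1 + (size x.2).-1)%N.

Definition moves_check h := all (fun e =>
   zpeq (displacement e.1) (move_sum e.2.1 e.2.2) && (out_stage e.2 <= 4)%N) (stages h).
(** After each move but the last one, the point must lie in the strip into which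
this move is meant to slide it. *)
Fixpoint mids i (v : zpoint) (s : seq Z) : seq constraint :=
  if s is c :: s' then
    if s' is [::] then [::] else
    let w := zplus v (zscale c (zmove i)) in
    map (translate w) (strip_pair i) ++ mids i.+1 w s'
  else [::].
Definition state h (e : (nat * nat) * (nat * seq Z)) := bound h e.2.1 :: region e.1.
Definition mids_check h := all (fun e =>
   entails_all (state h e) (mids e.2.1 (zcst 0, zcst 0) e.2.2)) (stages h).
(** A point of the origin that starts at stage s already lies in the first
s strips. *)
Definition start_check h := all (fun up => all (fun vw =>
   let hyps := origin h up ++ region vw in
   if find_stage h vw is Some x then entails_all hyps (bound h x.1 :: strips 0 x.1)
   else infeasible hyps) regions) bools.
(** An orbit that lands in the goal has crossed the remaining strips. *)
Definition landing_check h := all (fun e => all (fun up =>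
   let tr := translate (displacement e.1) in
   let hyps := state h e ++ map tr (goal h up) in
   entails_all hyps (map tr (strips (out_stage e.2) 4))) bools) (stages h).
(** The origin is not met again before the goal. *)
Definition no_return_check h := all (fun e => all (fun up =>
   let tr := translate (displacement e.1) in
   infeasible (state h e ++ map tr (origin h up))) bools) (stages h).
(* The goal is a union of two convex pieces, separated by the sign of y. *)
Definition lands h (tr : constraint -> constraint) hyps :=
  all (fun up => entails_all (tr (if up then y_ge_0 else y_le_0) :: hyps) (map tr (goal h up))) bools.
(** A step leads to a region of the same or of a later stage, in the strips between the
two, unless it lands in the goal. *)
Definition step_check h := all (fun e => all (fun vw =>
   let tr := translate (displacement e.1) in
   let hyps := state h e ++ map tr (region vw) in
   infeasible hyps ||
   if find_stage h vw is Some x then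
     if (out_stage e.2 <= x.1)%N then
       entails_all (tr (bound h x.1) :: hyps) (map tr (strips (out_stage e.2) x.1)) &&
       lands h tr (con_opp (tr (bound h x.1)) :: hyps)
     else lands h tr hyps
   else lands h tr hyps) regions) (stages h).

Definition half_check h := [&& moves_check h, mids_check h, start_check h,
  landing_check h, no_return_check h & step_check h].

Lemma right_half_check : half_check right_half.
Proof. by vm_compute. Qed.
Lemma left_half_check : half_check left_half.
Proof. by vm_compute. Qed.

(** * The kite and the outer billiards map *)

Section Plane.
Variable R : realType.
Implicit Types p q : R * R.

Definition zpt (v : zpoint) : R * R := (zval R v.1, zval R v.2).

Lemma phi_neg3 : (phi R) ^- 3 = zval R (-3, 2)%Zc.
Proof.
rewrite -exprVn phi_inv /zval /= (_ : zr R (-3)%Zc = -3) // (_ : zr R 2 = 2) //.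
have := phi_sqr R; set x := phi R => x2.
transitivity (x ^+ 2 * x - 3 * x ^+ 2 + 3 * x - 1); first by ring.
by rewrite x2 mulrDl -expr2 x2; ring.
Qed.

Lemma zval0 : zval R (0, 0)%Zc = 0.
Proof. by rewrite (zval_cst R 0). Qed.
Lemma zval1 : zval R (1, 0)%Zc = 1.
Proof. by rewrite (zval_cst R 1). Qed.
Lemma zvalN1 : zval R (-1, 0)%Zc = -1.
Proof. by rewrite (zval_cst R (-1)). Qed.

Lemma kite_verticesE : kite_vertices R = map zpt zvertices.
Proof. by rewrite /kite_vertices /zvertices /= /zpt /= !(zval0, zval1, zvalN1) phi_neg3. Qed.

Lemma lhs_side s v w p : lhs (side s v w) p = - cross (zpt v - p) (zpt w - p).
Proof. by rewrite /lhs /cross /= /zsub !(zvalD, zvalN, zvalM) /=; ring. Qed.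

Lemma lhs_translate v c p : lhs (translate v c) p = lhs c (p + zpt v).
Proof. by rewrite /lhs /= !(zvalD, zvalM); ring. Qed.

Lemma sat_translate v c p : sat p (translate v c) = sat (p + zpt v) c.
Proof. by rewrite /sat lhs_translate. Qed.

Lemma all_translate v cs p : all (sat p) (map (translate v) cs) = all (sat (p + zpt v)) cs.
Proof. by rewrite all_map; apply: eq_all => c; exact: sat_translate. Qed.

Lemma sat_reflect v c p : sat p (reflect_con v c) = sat (zpt v + zpt v - p) c.
Proof.
by rewrite /sat (_ : lhs (reflect_con v c) p = lhs c (zpt v + zpt v - p)) // /lhs /=
  !(zvalD, zvalN, zvalM) zval_cst (_ : zr R 2 = 2) //; ring.
Qed.

Lemma lhs_hull (s : seq (R * R)) c p : hull s p ->
  exists2 a : 'I_(size s) -> R, (forall i, 0 <= a i) & lhs c p = \sum_i a i * lhs c s`_i.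
Proof.
move=> [a [a0 a1 ->]]; exists a => //.
have fstE : (\sum_i a i *: s`_i).1 = \sum_i a i * (s`_i).1.
  by rewrite (raddf_sum fst).
have sndE : (\sum_i a i *: s`_i).2 = \sum_i a i * (s`_i).2.
  by rewrite (raddf_sum snd).
rewrite /lhs fstE sndE -[X in _ + X = _]mul1r -a1 !mulr_sumr mulr_suml -!big_split.
by apply: eq_bigr => i _ /=; ring.
Qed.

Lemma hull_lhs_ge0 (s : seq (R * R)) c p : (forall q, q \in s -> 0 <= lhs c q) ->
  hull s p -> 0 <= lhs c p.
Proof.
move=> sc /(lhs_hull c)[a a0 ->]; apply: sumr_ge0 => i _.
by rewrite mulr_ge0 // sc // mem_nth.
Qed.

Lemma zvertex_mem i : (i < 4)%N -> zpt (zvertex i) \in kite_vertices R.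
Proof. by move=> i4; rewrite kite_verticesE map_f // mem_nth. Qed.

Lemma kite_vertices_nth i : (i < 4)%N -> (kite_vertices R)`_i = zpt (zvertex i).
Proof. by move=> i4; rewrite kite_verticesE (nth_map (zcst 0, zcst 0)). Qed.

Lemma kite_on_rightP i p : (i < 4)%N ->
  reflect (all (sat p) (cone false i)) (kite_on_right p (zpt (zvertex i))).
Proof.
move=> i4; apply: (iffP (asboolP _)) => [H|H w kw].
  apply/allP => _ /mapP[j + ->]; rewrite mem_filter mem_iota => /andP[_ j4].
  rewrite /sat lhs_side /= oppr_ge0; apply: H.
  exact/mem_hull/zvertex_mem.
(* The cross product is an affine function of w, to be checked at the vertices. *)
pose x := zpt (zvertex i) - p.
have [a [a0 a1 Ew]] := kw.
have fstE : w.1 = \sum_i a i * ((kite_vertices R)`_i).1 by rewrite Ew (raddf_sum fst).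
have sndE : w.2 = \sum_i a i * ((kite_vertices R)`_i).2 by rewrite Ew (raddf_sum snd).
have -> : cross x (w - p) = \sum_j a j * cross x ((kite_vertices R)`_j - p).
  rewrite /cross /= fstE sndE.
  transitivity (x.1 * (\sum_j a j * ((kite_vertices R)`_j).2 - (\sum_j a j) * p.2)
    - x.2 * (\sum_j a j * ((kite_vertices R)`_j).1 - (\sum_j a j) * p.1)).
    by rewrite a1 !mul1r.
  rewrite !mulr_suml -!sumrB !mulr_sumr -sumrB.
  by apply: eq_bigr => j _; rewrite /x /=; ring.
apply: sumr_le0 => j _; rewrite mulr_ge0_le0 //.
have j4 : (j < 4)%N := ltn_ord j.
have -> : (kite_vertices R)`_j = zpt (zvertex j).
  exact: kite_vertices_nth.
have [->|ji] := eqVneq (nat_of_ord j) i.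
  by rewrite /cross mulrC subrr.
have := allP H (side false (zvertex i) (zvertex j)).
rewrite /sat lhs_side /= oppr_ge0; apply.
by apply/mapP; exists (nat_of_ord j) => //; rewrite mem_filter ji mem_iota.
Qed.

Lemma outer_billiardsP p q : outer_billiards p = Some q ->
  exists i, [/\ (i < 4)%N, ~ kite p, q = zpt (zvertex i) + zpt (zvertex i) - p,
    kite_on_right p (zpt (zvertex i)) &
    forall j, (j < 4)%N -> j != i -> ~~ kite_on_right p (zpt (zvertex j))].
Proof.
rewrite /outer_billiards; case: ifPn => // /asboolP Kp.
have -> : kite_vertices R = [seq zpt (zvertex i) | i <- iota 0 4].
  by rewrite kite_verticesE.
pose b i := kite_on_right p (zpt (zvertex i)).
rewrite /= -!/(b _).
case E0: (b 0%N); case E1: (b 1%N); case E2: (b 2%N); case E3: (b 3%N) => //= -[<-].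
- by exists 0%N; split=> // -[|[|[|[|//]]]] //= _ _; rewrite -/(b _) ?E1 ?E2 ?E3.
- by exists 1%N; split=> // -[|[|[|[|//]]]] //= _ _; rewrite -/(b _) ?E0 ?E2 ?E3.
- by exists 2%N; split=> // -[|[|[|[|//]]]] //= _ _; rewrite -/(b _) ?E0 ?E1 ?E3.
- by exists 3%N; split=> // -[|[|[|[|//]]]] //= _ _; rewrite -/(b _) ?E0 ?E1 ?E2.
Qed.

Definition orient (p q r : R * R) : R := cross (q - p) (r - p).

(* The coefficients are quotients of oriented areas. *)
Lemma hull_triangle (u v w p : R * R) : orient u v w < 0 ->
  orient p u v <= 0 -> orient p v w <= 0 -> orient p w u <= 0 ->
  hull [:: u; v; w] p.
Proof.
move=> D0 h1 h2 h3; pose D := orient u v w.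
have Dn : D != 0 by rewrite lt_eqF.
pose a (i : 'I_3) := nth 0 [:: orient p v w / D; orient p w u / D; orient p u v / D] i.
exists a; split.
- by move=> -[[|[|[|//]]] hi]; rewrite /a /= -mulrNN -invrN mulr_ge0 ?invr_ge0 ?oppr_ge0 // ltW.
- rewrite !big_ord_recl big_ord0 /a /= addr0 -!mulrDl.
  apply/eqP; rewrite -(inj_eq (mulIf Dn)) divfK // mul1r; apply/eqP.
  by rewrite /D /orient /cross /=; ring.
- rewrite !big_ord_recl big_ord0 /a /= addr0.
  rewrite ![_ / D]mulrC -!scalerA -!scalerDr; apply: (scalerI Dn); rewrite scalerA divff // scale1r.
  by apply: injective_projections; rewrite /D /orient /cross /= -![_ *: _]/(_ * _); ring.
Qed.

End Plane.

(** * Orbits and itineraries *)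

(* The boundary is followed clockwise, with the kite on the right. *)
Definition kite_edges : seq (nat * nat) := [:: (0, 1); (1, 3); (3, 2); (2, 0)]%N.
Definition kite_sides : seq constraint :=
  [seq side false (zvertex e.1) (zvertex e.2) | e <- kite_edges].

Definition zlhs (c : constraint) (v : zpoint) : zphi :=
  zadd (zadd (zmul (cx c) v.1) (zmul (cy c) v.2)) (cc c).
Definition znonneg x := zpos x || zeq x (zcst 0).

Definition triangle_sides (u v w : zpoint) : seq constraint :=
  [:: side false u v; side false v w; side false w u].

Section Shapes.
Variable R : realType.
Implicit Types p q : R * R.

Lemma lhs_zpt c v : lhs c (zpt R v) = zval R (zlhs c v).
Proof. by rewrite /lhs /zlhs !(zvalD, zvalM). Qed.

Lemma hull_sat (vs : seq zpoint) cs p :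
  all (fun c => ~~ strict c && all (fun v => znonneg (zlhs c v)) vs) cs ->
  hull (map (zpt R) vs) p -> all (sat p) cs.
Proof.
move=> /allP H hp; apply/allP => c /H /andP[/negbTE sc /allP Hc]; rewrite /sat sc.
apply: hull_lhs_ge0 hp => _ /mapP[v /Hc + ->]; rewrite lhs_zpt.
move=> /orP[/(zposP R)/ltW//|/(zvalE R) ->]; by rewrite zval_cst.
Qed.

Lemma hull_triangle_sat (u v w : zpoint) p : zpos (zlhs (side true u v) w) ->
  all (sat p) (triangle_sides u v w) -> hull (map (zpt R) [:: u; v; w]) p.
Proof.
move=> /(zposP R); rewrite -lhs_zpt lhs_side oppr_gt0 => D.
rewrite /= /sat !lhs_side /= !oppr_ge0 andbT => /and3P[h1 h2 h3].
apply: hull_triangle => //; suff -> : orient (zpt R u) (zpt R v) (zpt R w) =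
  cross (zpt R u - zpt R w) (zpt R v - zpt R w) by [].
by rewrite /orient /cross /=; ring.
Qed.

Lemma kite_sat p : kite p -> all (sat p) kite_sides.
Proof. by rewrite /kite kite_verticesE; apply: hull_sat; vm_compute. Qed.

Lemma sat_kite p : all (sat p) kite_sides -> kite p.
Proof.
move=> kp; have tri (vs : seq nat) : all (fun i => i < 4)%N vs ->
    hull (map (zpt R) (map zvertex vs)) p -> kite p.
  move=> /allP v4; apply: hull_trans => _ /mapP[_ /mapP[i /v4 i4 ->] ->].
  exact/mem_hull/zvertex_mem.
(* The horizontal diagonal cuts the kite into two triangles. *)
case: (boolP (sat p y_ge_0)) => y0.
  apply: (tri [:: 0; 1; 3]%N) => //; apply: hull_triangle_sat; first by vm_compute.
  by apply: (@entails_allP R p (y_ge_0 :: kite_sides)); [vm_compute|rewrite /= y0].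
apply: (tri [:: 0; 3; 2]%N) => //; apply: hull_triangle_sat; first by vm_compute.
by apply: (@entails_allP R p (con_opp y_ge_0 :: kite_sides)); [vm_compute|rewrite /= sat_opp y0].
Qed.

(** A point outside the kite on the line of two vertices sees the kite on the
right of both or of none: where the map is defined, the inequalities are strict. *)
Lemma cone_strict_check : all (fun e => all (fun i => all (fun j => (i == j) ||
  entails_all [:: con_opp e, con_opp (side true (zvertex i) (zvertex j)) & cone false i]
    (cone false j)) (iota 0 4)) (iota 0 4)) kite_sides.
Proof. by vm_compute. Qed.

Lemma outer_billiards_cone p q : outer_billiards p = Some q -> exists i,
  [/\ (i < 4)%N, q = zpt R (zvertex i) + zpt R (zvertex i) - p & all (sat p) (cone true i)].
Proof.
move=> /outer_billiardsP[i [i4 Kp qE /(kite_on_rightP _ i4) ci nj]].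
exists i; split=> //; apply/allP => c /mapP[j]; rewrite mem_filter mem_iota => /andP[ji j4] ->.
apply/negPn/negP => sj.
have /allPn[e eK se] : ~~ all (sat p) kite_sides by apply/negP => /sat_kite.
have := nj j j4 ji; move/negP; apply; apply/(kite_on_rightP _ j4).
have := allP cone_strict_check e eK => /all_iota/(_ i4)/all_iota/(_ j4).
rewrite eq_sym (negbTE ji) /= => /entails_allP; apply.
by rewrite /= !sat_opp se sj.
Qed.

Lemma psi_region p q : psi p = Some q -> exists vw, [/\ vw \in regions,
  all (sat p) (region vw) & q = p + zpt R (displacement vw)].
Proof.
rewrite /psi; case E: (outer_billiards p) => [p'|//] /= E'.
have [i [i4 p'E ci]] := outer_billiards_cone E.
have [j [j4 qE cj]] := outer_billiards_cone E'.
exists (i, j); split.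
- by apply/allpairsP; exists (i, j); rewrite !mem_iota.
- rewrite /region all_cat ci all_map /=; apply: sub_all cj => c.
  by rewrite /preim /= sat_reflect -p'E.
- rewrite qE p'E /displacement /zscale /zplus /zpt /= !(zvalM, zvalD, zval_cst).
  rewrite (_ : zr R 2 = 2) // (_ : zr R (-1)%Zc = -1) //.
  by apply: injective_projections => /=; ring.
Qed.

End Shapes.

Section Flow.
Variable R : realType.
Local Notation form := (form3 R).
Local Notation vec := (vec3 R).
Local Notation off := (offset R).
Local Notation T := (torus R 3).
Implicit Types (p q : R * R) (t : T) (w : 'rV[R]_3).

(** The point w reaches t by sliding successively along the vectors of index
j, j + 1, and so on, into the interiors of the n corresponding strips. *)
Fixpoint flows (n j : nat) w t : Prop :=
  if n is n'.+1 then exists k : int,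
    off j < dot (form j) (w + k%:~R *: vec j) < off j + 2 /\
    flows n' j.+1 (w + k%:~R *: vec j) t
  else \pi_T w = t.

Lemma flows_itinerary n j w (k : nat -> int) :
  (forall i, (i < n)%N ->
     off (j + i) + 2 * (k i)%:~R < dot (form (j + i)) (w + \sum_(l < i) (k l)%:~R *: vec (j + l))
       < off (j + i) + 2 * (k i)%:~R + 2) ->
  (j + n <= 8)%N ->
  flows n j w (\pi_T (w + \sum_(l < n) (k l)%:~R *: vec (j + l))).
Proof.
elim: n j w k => [|n IHn] j w k H j8; first by rewrite big_ord0 addr0.
have j8' : (j < 8)%N by lia.
exists (k 0%N); split.
  have := H 0%N isT; rewrite big_ord0 !addr0 addn0 dotDr dotZr form_vec //.
  by move=> /andP[h1 h2]; apply/andP; split; lra.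
have shift m : \sum_(l < m.+1) (k l)%:~R *: vec (j + l) =
    (k 0%N)%:~R *: vec j + \sum_(l < m) (k l.+1)%:~R *: vec (j.+1 + l).
  rewrite big_ord_recl addn0; congr (_ + _); apply: eq_bigr => l _.
  by rewrite /= /bump /= add1n addSnnS.
rewrite shift addrA; apply: (IHn _ _ (fun l => k l.+1)); last by lia.
by move=> i ni; have := H i.+1 ni; rewrite shift addrA addSnnS.
Qed.

(** For n = 0 the index j is 8, and vec 8 = vec 0 belongs to the lattice of the
torus. *)
Lemma flows_slide n j w t (m : int) : (n + j = 8)%N ->
  flows n j w t -> flows n j (w + m%:~R *: vec j) t.
Proof.
case: n => [|n] nj.
  move: nj; rewrite add0n /= => -> <-; apply: torus_piD; apply/even_latticeP => -[[|[|[|//]]] h].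
  - by exists 0; rewrite !mxE /zval /= !zr_consts; ring.
  - by exists (- m); rewrite !mxE /zval /= !zr_consts rmorphN /=; ring.
  - by exists (2 * m); rewrite !mxE /zval /= !zr_consts rmorphM /=; ring.
move=> [k [h1 h2]]; exists (k - m).
by rewrite rmorphB /= -addrA -scalerDl (addrC m%:~R) subrK.
Qed.

(** A point of the closed strip that reaches its interior along a vector crossing
the strip does not move: the number of steps is an integer of modulus less than 1. *)
Lemma flows_strip n j w t : (j < 8)%N ->
  off j <= dot (form j) w <= off j + 2 -> flows n.+1 j w t -> flows n j.+1 w t.
Proof.
move=> j8 /andP[h1 h2] [k []]; rewrite dotDr dotZr form_vec // => /andP[h3 h4].
have -> : k = 0 by apply: (@int_near0 R); lra.
by rewrite scale0r addr0.
Qed.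

Lemma zmove_check : all (fun i =>
  let e := nth (zcst 0) (zvec i) in
  [&& zeq (zmul (zmove i).1 (-1, 1)%Zc) (e 0%N),
      zeq (zsub (zmove i).1 (zmove i).2) (zmul (zcst 2) (e 1%N)) &
      zeq (zmove i).2 (e 2%N)]) (iota 0 4).
Proof. by vm_compute. Qed.

Lemma Theta_lift_move q i (c : Z) :
  Theta_lift (q + zpt R (zscale c (zmove i))) = Theta_lift q + (int_of_Z c)%:~R *: vec i.
Proof.
have i4 : (i %% 4 < 4)%N by rewrite ltn_mod.
have /and3P[/(zvalE R) + /(zvalE R) + /(zvalE R)] := all_iota zmove_check i4.
rewrite /vec3 /zvec /zmove !modn_mod /zsub !(zvalM, zvalD, zvalN) !zval_cst.
set x := zval R _.1; set y := zval R _.2.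
rewrite [zval R (-1, 1)%Zc](_ : _ = phi R - 1); last by rewrite /zval /= !zr_consts; ring.
rewrite (_ : zr R 2 = 2) // => e0 e1 e2.
apply: rowP3; rewrite !mxE /= !zvalM !zval_cst -/x -/y -/(zr R c).
- by rewrite -e0 -phi_inv; ring.
- have -> : zval R (nth (zcst 0) (nth [::] slide_vectors (i %% 4)) 1) = (x - y) / 2.
    by rewrite e1; field.
  by field.
- by rewrite e2.
Qed.

Lemma strip_satE q i : all (sat q) (strip_pair i) =
  (off i <= dot (form i) (Theta_lift q) <= off i + 2).
Proof.
have E : lhs (nth y_ge_0 (strip_pair i) 0) q = 2 * (dot (form i) (Theta_lift q) - off i).
  rewrite /lhs /= !(zvalD, zvalM, zvalN) /dot !big_ord_recl big_ord0 !mxE /= /bump /=.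
  rewrite /offset phi_inv [zval R (2, 0)%Zc](_ : _ = 2); last by rewrite (zval_cst R 2).
  rewrite [zval R (-2, 0)%Zc](_ : _ = -2); last by rewrite (zval_cst R (-2)).
  rewrite [zval R (-2, 2)%Zc](_ : _ = 2 * (phi R - 1)); last first.
    by rewrite /zval /= !zr_consts; ring.
  by field.
have E' : lhs (nth y_ge_0 (strip_pair i) 1) q = 4 - lhs (nth y_ge_0 (strip_pair i) 0) q.
  rewrite /lhs /= !(zvalD, zvalM, zvalN) [zval R (4, 0)%Zc](_ : _ = 4); last by rewrite (zval_cst R 4).
  by ring.
rewrite [strip_pair i](_ : _ = [:: nth y_ge_0 (strip_pair i) 0; nth y_ge_0 (strip_pair i) 1]) //.
rewrite /= andbT /sat E' E /=.
by congr (_ && _); apply/idP/idP => ?; lra.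
Qed.

(** In the plane, the strips of the two halves of a turn are the same. *)
Lemma strip_pair_periodic : all (fun i => strip_pair (4 + i) == strip_pair i) (iota 0 4).
Proof. by vm_compute. Qed.

(* The half-turn that starts at b = 0 is the first one, at b = 4 the second one. *)
Variables (b : nat) (b04 : b = 0%N \/ b = 4%N).

(** The invariant of orbits: the remaining slides lead to the same point t of
the torus. *)
Definition on_course s q t := flows (8 - (b + s)) (b + s) (Theta_lift q) t.

Lemma on_course_strip s q t : (s < 4)%N -> all (sat q) (strip_pair s) ->
  on_course s q t -> on_course s.+1 q t.
Proof.
move=> s4 qs; rewrite /on_course addnS.
have bs8 : (b + s < 8)%N by case: b04 => ->; lia.
rewrite -[(8 - (b + s))%N]prednK ?subn_gt0 // -subnS; apply: flows_strip => //.
rewrite -strip_satE; case: b04 => ->; first by [].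
by have /eqP -> := all_iota strip_pair_periodic s4.
Qed.

Lemma on_course_strips i j q t : (i <= j <= 4)%N -> all (sat q) (strips i j) ->
  on_course i q t -> on_course j q t.
Proof.
move=> /andP[ij j4] H ci.
suff step n : forall k, (k + n <= 4)%N -> all (sat q) (flatten [seq strip_pair l | l <- iota k n]) ->
    on_course k q t -> on_course (k + n) q t.
  by have := step (j - i)%N i; rewrite subnKC //; apply.
elim: n => [|n IHn] k kn /=; first by rewrite addn0.
move=> /and3P[s0 s1 s2] ck; rewrite addnS -addSn; apply: IHn => //; first by lia.
by apply: on_course_strip ck; [lia|rewrite /= s0 s1].
Qed.

Lemma on_course_move s q t c : (s <= 4)%N ->
  on_course s q t -> on_course s (q + zpt R (zscale c (zmove s))) t.
Proof.
move=> s4; rewrite /on_course Theta_lift_move.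
have -> : vec s = vec (b + s).
  by rewrite /vec3 /zvec; case: b04 => -> //; rewrite modnDl.
by apply: flows_slide; case: b04 => ->; lia.
Qed.

Lemma zpt_plus (v w : zpoint) : zpt R (zplus v w) = zpt R v + zpt R w.
Proof. by rewrite /zpt /= !zvalD. Qed.

Lemma on_course_moves s ms q v t : (s + (size ms).-1 <= 4)%N -> all (sat q) (mids s v ms) ->
  on_course s (q + zpt R v) t ->
  on_course (s + (size ms).-1) (q + zpt R v + zpt R (move_sum s ms)) t.
Proof.
elim: ms s v => [|c [|c' ms] IHms] s v s4.
- by rewrite /= addn0 /zpt /= !zval_cst (_ : (zr R 0, zr R 0) = 0) // addr0.
- move=> _ H; rewrite /= addn0 zpt_plus addrA.
  rewrite [X in _ + X](_ : zpt R (zcst 0, zcst 0) = 0) ?addr0; last by rewrite /zpt /= zval_cst.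
  by apply: on_course_move => //; rewrite addn0 in s4.
have -> : mids s v (c :: c' :: ms) = let w := zplus v (zscale c (zmove s)) in
    map (translate w) (strip_pair s) ++ mids s.+1 w (c' :: ms) by [].
cbv zeta; rewrite all_cat all_translate => /andP[h1 h2] H.
have s4' : (s < 4)%N by move: s4 => /=; lia.
have H' : on_course s (q + zpt R (zplus v (zscale c (zmove s)))) t.
  by rewrite zpt_plus addrA; apply: on_course_move => //; exact: ltnW.
have := IHms s.+1 _ _ h2 (on_course_strip s4' h1 H').
have -> : move_sum s (c :: c' :: ms) =
  zplus (zscale c (zmove s)) (move_sum s.+1 (c' :: ms)) by [].
rewrite !zpt_plus !addrA /= addnS addSn; apply.
by move: s4 => /=; lia.
Qed.

End Flow.

(** * Half a turn around the kite *)

Section HalfTurn.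
Variable R : realType.
Local Notation T := (torus R 3).
Implicit Types (p q z : R * R) (t : T).

Definition in_pieces (P : bool -> seq constraint) : set (R * R) :=
  [set p | exists up, all (sat p) (P up)].

Definition psi_orbit m p : option (R * R) := iter m (obind (@psi R)) (Some p).

Lemma psi_orbitD m n p q : psi_orbit m p = Some q -> psi_orbit (n + m) p = psi_orbit n q.
Proof. by rewrite /psi_orbit iterD => ->. Qed.

Lemma psi_orbitS n p z : psi_orbit n.+1 p = Some z ->
  exists q, psi p = Some q /\ psi_orbit n q = Some z.
Proof.
rewrite /psi_orbit iterSr /=; case: (psi p) => [q|]; first by exists q.
by rewrite (_ : iter n _ None = None) //; elim: n => //= n ->.
Qed.

Variables (h : turn_table) (b : nat).
Hypothesis h_check : half_check h.
Hypothesis b04 : b = 0%N \/ b = 4%N.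

Lemma in_bools (P : pred bool) up : all P bools -> P up.
Proof. by move=> /and3P[? ? _]; case: up. Qed.

Lemma find_stage_mem vw x : find_stage h vw = Some x -> (vw, x) \in stages h.
Proof.
rewrite /find_stage; case E: [seq _ | _ <- _ & _] => [|y s] // [<-].
have : y \in [seq e.2 | e <- stages h & e.1 == vw] by rewrite E mem_head.
by case/mapP=> -[vw' x']; rewrite mem_filter /= => /andP[/eqP -> ?] ->.
Qed.

Lemma landsP hyps (tr : constraint -> constraint) p q :
  lands h tr hyps -> (forall c, sat p (tr c) = sat q c) -> all (sat p) hyps ->
  in_pieces (goal h) q.
Proof.
move=> H trE ph.
have land up : sat q (if up then y_ge_0 else y_le_0) -> in_pieces (goal h) q.
  move=> yq; exists up; have := in_bools up H => /(@entails_allP R p).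
  rewrite /= ph andbT trE yq => /(_ isT).
  by rewrite all_map; apply: sub_all => c; rewrite /preim /= trE.
case: (boolP (sat q y_ge_0)) => [/(land true)//|]; rewrite -sat_opp => yq.
apply: (land false); apply: (@entailsP R q [:: con_opp y_ge_0]); first by vm_compute.
by rewrite /= yq.
Qed.

Lemma half_turn_step q t e (q' := q + zpt R (displacement e.1)) :
  e \in stages h -> all (sat q) (state h e) -> on_course b e.2.1 q t ->
  [/\ on_course b (out_stage e.2) q' t,
      in_pieces (goal h) q' -> on_course b 4 q' t &
      ~ in_pieces (origin h) q'].
Proof.
have /and5P[Cm Cd _ Cl /andP[Cn _]] := h_check.
move=> eS qS qt.
have /andP[/andP[/(zvalE R) m1 /(zvalE R) m2] out4] := allP Cm e eS.
have q't : on_course b (out_stage e.2) q' t.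
  have q0 : q + zpt R (zcst 0, zcst 0) = q.
    by rewrite /zpt /= !zval_cst; apply: injective_projections => /=; exact: addr0.
  have mv : zpt R (displacement e.1) = zpt R (move_sum e.2.1 e.2.2) by rewrite /zpt m1 m2.
  have := on_course_moves (t := t) (v := (zcst 0, zcst 0)) b04 out4
    (entails_allP (allP Cd e eS) qS).
  by rewrite q0 => /(_ qt); rewrite -mv.
split=> //.
  move=> [up gq']; have := in_bools up (allP Cl e eS) => /(@entails_allP R q).
  rewrite all_cat qS !all_translate gq' => /(_ isT) st.
  by apply: on_course_strips st q't => //; rewrite out4.
move=> [up oq']; have := in_bools up (allP Cn e eS) => /(@infeasibleP R q).
by rewrite all_cat qS all_translate oq'.
Qed.

(** The orbit of q is followed until it lands in the goal.  That it comes to z in the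
goal or in the origin excludes that it wanders off forever. *)
Lemma half_turn_from n q z t e : e \in stages h -> all (sat q) (state h e) ->
  psi q = Some (q + zpt R (displacement e.1)) ->
  on_course b e.2.1 q t -> psi_orbit n.+1 q = Some z ->
  in_pieces (goal h) z \/ in_pieces (origin h) z ->
  exists m q', [/\ (m <= n)%N, psi_orbit m.+1 q = Some q', in_pieces (goal h) q' &
                   on_course b 4 q' t].
Proof.
have /and5P[Cm _ _ _ /andP[_ Cs]] := h_check.
elim: n q e => [|n IHn] q e eS qS psiq qt; have := half_turn_step eS qS qt;
  set q' := q + _ in psiq * => -[q't land nsrc].
  rewrite /psi_orbit /= psiq => -[<-] [gz|//].
  by exists 0%N, q'; rewrite /psi_orbit /= psiq; split=> //; exact: land.
case: (pselect (in_pieces (goal h) q')) => gq'.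
  by exists 0%N, q'; rewrite /psi_orbit /= psiq; split=> //; exact: land.
move=> oz0 zP; have [x [+ oz]] := psi_orbitS oz0; rewrite psiq => -[qE]; rewrite -{x}qE in oz.
have [q'' [psiq' _]] := psi_orbitS oz.
have [vw [vwR q'R q''E]] := psi_region psiq'.
have /allP := allP Cs e eS.
have hyps : all (sat q) (state h e ++ map (translate (displacement e.1)) (region vw)).
  by rewrite all_cat qS all_translate.
have nland cs : all (sat q) cs -> ~~ lands h (translate (displacement e.1)) cs.
  move=> csq; apply/negP => /landsP H; apply: gq'; apply: (H _ _ _ csq) => c.
  exact: sat_translate.
move=> /(_ _ vwR) /=.
have /negbTE -> : ~~ infeasible (state h e ++ map (translate (displacement e.1)) (region vw)).
  by apply/negP => /(@infeasibleP R q)/negP.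
rewrite (negbTE (nland _ hyps)).
case E: find_stage => [x|//]; case: ifP => // ox /andP[H1 H2].
have bq' : sat q' (bound h x.1).
  rewrite -sat_translate; apply: contraTT H2; rewrite -sat_opp => nb.
  by apply: nland; rewrite /= nb.
have eS' := find_stage_mem E.
have x4 : (x.1 <= 4)%N.
  by have /andP[_] := allP Cm _ eS'; apply: leq_trans; exact: leq_addr.
have st : all (sat q') (strips (out_stage e.2) x.1).
  by rewrite -all_translate; apply: entails_allP H1 _; rewrite /= sat_translate bq'.
have [|||m [r [mn mr rg rt]]] := IHn q' (vw, x) eS' _ _ _ oz zP.
- by rewrite /state /= bq'.
- by rewrite psiq' q''E.
- by apply: on_course_strips st q't => //; rewrite ox.
exists m.+1, r; split=> //.
by rewrite -addn1 (psi_orbitD _ (q := q')) // /psi_orbit /= psiq.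
Qed.

Lemma half_turn n p z t : in_pieces (origin h) p -> on_course b 0 p t ->
  psi_orbit n.+1 p = Some z -> in_pieces (goal h) z \/ in_pieces (origin h) z ->
  exists m q', [/\ (m <= n)%N, psi_orbit m.+1 p = Some q', in_pieces (goal h) q' &
                   on_course b 4 q' t].
Proof.
have /and5P[Cm _ Co _ _] := h_check.
move=> [up op] pt oz zP; have [p' [psip _]] := psi_orbitS oz.
have [vw [vwR pR p'E]] := psi_region psip.
have := allP (in_bools up Co) vw vwR.
have hyps : all (sat p) (origin h up ++ region vw) by rewrite all_cat op.
case E: find_stage => [x|]; last by move=> /(@infeasibleP R p)/negP.
move=> /entails_allP/(_ hyps) /= /andP[pb ps].
have eS := find_stage_mem E.
have x4 : (x.1 <= 4)%N.
  by have /andP[_] := allP Cm _ eS; apply: leq_trans; exact: leq_addr.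
apply: half_turn_from eS _ _ _ oz zP.
- by rewrite /state /= pb.
- by rewrite psip p'E.
- exact: on_course_strips ps pt.
Qed.

End HalfTurn.

(** * The return map *)

Section FirstReturn.
Variable R : realType.
Implicit Types (p q z : R * R) (t : torus R 3).

(** A return is made of two half-turns; the landing of the second one is the first
passage in the origin. *)
Lemma first_return_on_course h h' p z t : half_check h -> half_check h' ->
  goal h = origin h' -> goal h' = origin h ->
  (forall q, in_pieces (origin h) q -> ~ in_pieces (goal h) q) ->
  first_return (@psi R) (in_pieces (origin h)) p z ->
  on_course 0 0 p t -> \pi_(torus R 3) (Theta_lift z) = t.
Proof.
move=> ch ch' gh gh' disj [op oz [n [n0 pz nret]]] pt; case: n n0 pz nret => // n _ pz nret.
have {}pz : psi_orbit n.+1 p = Some z by [].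
have [m [q [mn pq gq qt]]] := half_turn ch (or_introl erefl) op pt pz (or_intror oz).
have mn' : (m < n)%N.
  rewrite ltn_neqAle mn andbT; apply/eqP => mE.
  by move: pq; rewrite mE pz => -[qz]; apply: (disj z oz); rewrite qz.
have qz : psi_orbit (n - m.+1).+1 q = Some z.
  by rewrite -(psi_orbitD _ pq); have -> : ((n - m.+1).+1 + m.+1 = n.+1)%N by lia.
have oq : in_pieces (origin h') q by rewrite -gh.
have [m' [q' [mn'' qq' gq' q't]]] := half_turn ch' (or_intror erefl) oq qt qz
  (or_introl (eq_ind_r (fun P => in_pieces P z) oz gh')).
have pq' : psi_orbit (m'.+1 + m.+1) p = Some q' by rewrite (psi_orbitD _ pq).
have [E|E] := eqVneq (m'.+1 + m.+1)%N n.+1.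
  by move: pq' q't; rewrite E pz => -[<-].
rewrite gh' in gq'; have := nret (m'.+1 + m.+1)%N q' _ pq'; case; last by [].
by move/eqP: E; lia.
Qed.

(** On the kite and on B, half a turn is a loop: explicit moves through the four
strips that add up to zero. *)
Lemma fixed_on_course b cs ms p t : b = 0%N \/ b = 4%N ->
  entails_all cs (mids 0 (zcst 0, zcst 0) ms) -> size ms = 5%N ->
  zpeq (move_sum 0 ms) (zcst 0, zcst 0) ->
  all (sat p) cs -> on_course b 0 p t -> on_course b 4 p t.
Proof.
move=> b04 H s5 /andP[/(zvalE R) x0 /(zvalE R) y0] /(entails_allP H) sp pt.
have z0 : zpt R (zcst 0, zcst 0) = 0 by rewrite /zpt /= zval_cst.
have := on_course_moves (s := 0) b04 _ sp; rewrite s5 z0 addr0 => /(_ _ isT pt).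
by rewrite [zpt R (move_sum _ _)](_ : _ = 0) ?addr0 // /zpt x0 y0.
Qed.

End FirstReturn.

Section Bands.
Local Open Scope Z_scope.
Let z a b : zphi := (a, b).
Definition upper_triangle : zpoint * zpoint * zpoint :=
  ((z 0 0, z 1 0), (z 3 (-2), z 2 0), (z 1 0, z 2 0)).
Definition lower_triangle : zpoint * zpoint * zpoint :=
  ((z 0 0, z (-1) 0), (z 1 0, z (-2) 0), (z 3 (-2), z (-2) 0)).
Definition band (up : bool) : seq constraint :=
  let '(u, v, w) := if up then upper_triangle else lower_triangle in triangle_sides u v w.
Definition y_far (up : bool) : constraint :=
  Con (z 0 0) (z (if up then 1 else -1) 0) (z (-1) 0) false.
End Bands.

Lemma kite_fixed_check :
  entails_all kite_sides (mids 0 (zcst 0, zcst 0) (nseq 5 Z0)).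
Proof. by vm_compute. Qed.

Lemma upper_band_fixed_check :
  entails_all (band true) (mids 0 (zcst 0, zcst 0) [:: -1; 1; 0; -1; 0]%Zc).
Proof. by vm_compute. Qed.

Lemma lower_band_fixed_check :
  entails_all (band false) (mids 0 (zcst 0, zcst 0) [:: 0; 1; 0; -1; -1]%Zc).
Proof. by vm_compute. Qed.

Lemma outside_check : all (fun up => all (fun cs =>
  infeasible (right_piece up ++ cs) && infeasible (left_piece up ++ cs))
  [:: kite_sides; band true; band false]) bools.
Proof. by vm_compute. Qed.

Lemma disjoint_check : all (fun up => all (fun up' =>
  infeasible (right_piece up ++ left_piece up')) bools) bools.
Proof. by vm_compute. Qed.

(** A point of Sigma that satisfies neither the last two conditions of a right
piece nor those of a left one lies in B for |y| >= 1, and in the kite otherwise. *)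
Lemma inside_check : all (fun up =>
  all (fun c => all (fun d =>
    let cs := take 2 (right_piece up) ++ [:: con_opp c; con_opp d] in
    entails_all (y_far up :: cs) (band up) &&
    entails_all (con_opp (y_far up) :: cs) kite_sides)
  (drop 2 (left_piece up))) (drop 2 (right_piece up))) bools.
Proof. by vm_compute. Qed.

Section Regions.
Variable R : realType.
Implicit Types (p q z : R * R).

Lemma zval_consts : (zval R (0, 0)%Zc = 0) * (zval R (1, 0)%Zc = 1) *
  (zval R (-1, 0)%Zc = -1) * (zval R (2, 0)%Zc = 2) * (zval R (-2, 0)%Zc = -2) *
  (zval R (-3, 2)%Zc = phi R ^- 3) * (zval R (3, -2)%Zc = - phi R ^- 3).
Proof.
have z37 : zval R (3, -2)%Zc = - phi R ^- 3.
  by rewrite phi_neg3 -zvalN; apply: zvalE.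
have := (zval_cst R 0, zval_cst R 1, zval_cst R (-1), zval_cst R 2, zval_cst R (-2)).
by rewrite /zcst !zr_consts => -[[[[-> ->] ->] ->] ->]; rewrite z37 phi_neg3.
Qed.

Lemma band_sat p : B p -> Sigma p /\ exists up, all (sat p) (band up).
Proof.
move=> [Sp [hp|hp]]; split=> //.
  exists true; apply: (@hull_sat R [:: upper_triangle.1.1; upper_triangle.1.2; upper_triangle.2]).
    by vm_compute.
  by rewrite /= /zpt /= !zval_consts.
exists false; apply: (@hull_sat R [:: lower_triangle.1.1; lower_triangle.2; lower_triangle.1.2]).
  by vm_compute.
by rewrite /= /zpt /= !zval_consts.
Qed.

Lemma sat_band p up : Sigma p -> all (sat p) (band up) -> B p.
Proof.
move=> Sp; case: up => bp; split=> //.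
  left; have := @hull_triangle_sat R _ _ _ p _ bp.
  by rewrite /= /zpt /= !zval_consts; apply; vm_compute.
right; have := @hull_triangle_sat R _ _ _ p _ bp.
rewrite /= /zpt /= !zval_consts => H; apply: hull_trans (H _); last by vm_compute.
move=> x; rewrite !inE => /or3P[] /eqP ->; apply: mem_hull; rewrite !inE eqxx ?orbT //.
Qed.

Definition right_set : set (R * R) := in_pieces right_piece.
Definition left_set : set (R * R) := in_pieces left_piece.

Lemma in_piecesP (P : bool -> seq constraint) p : in_pieces P p <->
  all (sat p) (P true) \/ all (sat p) (P false).
Proof. by split=> [[[] ?]|[?|?]]; [left|right|exists true|exists false]. Qed.

Let a := phi R ^- 3.

Lemma a_bounds : 0 < a < 1.
Proof.
rewrite /a phi_neg3 /zval /= (_ : zr R (-3)%Zc = -3) // (_ : zr R 2 = 2) //.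
by have /andP[h1 h2] := phi_bounds R; apply/andP; split; lra.
Qed.

Lemma right_setP p : right_set p <->
  [/\ -2 < p.2, p.2 <= 2, `|p.2| - 1 < p.1 & a * (1 - `|p.2|) < p.1].
Proof.
rewrite /right_set in_piecesP /= /sat /= /lhs /= !zval_consts -/a.
have /andP[a0 a1] := a_bounds.
have [y0|y0] := leP 0 p.2.
  rewrite ger0_norm //; split.
    by move=> [/and5P[h1 h2 h3 h4 _]|/and5P[h1 h2 h3 h4 _]]; split; nra.
  move=> [h1 h2 h3 h4]; left; apply/and5P; split=> //; nra.
rewrite ltr0_norm //; split.
  by move=> [/and5P[h1 h2 h3 h4 _]|/and5P[h1 h2 h3 h4 _]]; split; nra.
by move=> [h1 h2 h3 h4]; right; apply/and5P; split=> //; nra.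
Qed.

Lemma left_setP p : left_set p <->
  [/\ -2 < p.2, p.2 <= 2, p.1 < `|p.2| - 1 & p.1 < a * (1 - `|p.2|)].
Proof.
rewrite /left_set in_piecesP /= /sat /= /lhs /= !zval_consts -/a.
have /andP[a0 a1] := a_bounds.
have [y0|y0] := leP 0 p.2.
  rewrite ger0_norm //; split.
    by move=> [/and5P[h1 h2 h3 h4 _]|/and5P[h1 h2 h3 h4 _]]; split; nra.
  move=> [h1 h2 h3 h4]; left; apply/and5P; split=> //; nra.
rewrite ltr0_norm //; split.
  by move=> [/and5P[h1 h2 h3 h4 _]|/and5P[h1 h2 h3 h4 _]]; split; nra.
by move=> [h1 h2 h3 h4]; right; apply/and5P; split=> //; nra.
Qed.

Lemma right_left_disjoint p : right_set p -> ~ left_set p.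
Proof.
move=> [up rp] [up' lp].
have := in_bools up' (in_bools up disjoint_check) => /(@infeasibleP R p).
by rewrite all_cat rp lp.
Qed.

Lemma complement_regions : @Sigma R `\` @kite R `\` @B R = right_set `|` left_set.
Proof.
apply/seteqP; split=> p.
  move=> [[Sp Kp] Bp]; have /andP[p1 p2] := Sp.
  pose up := 0 <= p.2.
  have yP : all (sat p) (take 2 (right_piece up)).
    rewrite /up; case: leP => y0; rewrite /= /sat /= /lhs /= !zval_consts.
      by apply/and3P; split=> //; lra.
    by apply/and3P; split=> //; lra.
  have split_piece (P : seq constraint) : all (sat p) (take 2 P) ->
      ~~ all (sat p) P -> exists2 c, c \in drop 2 P & sat p (con_opp c).
    rewrite -{2}(cat_take_drop 2 P) all_cat => -> /= /allPn[c cP sc].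
    by exists c; rewrite ?sat_opp.
  have yP' : all (sat p) (take 2 (left_piece up)) by move: yP; case: (up).
  have [rp|/(split_piece _ yP)[c cP sc]] := boolP (all (sat p) (right_piece up)).
    by left; exists up.
  have [lp|/(split_piece _ yP')[d dP sd]] := boolP (all (sat p) (left_piece up)).
    by right; exists up.
  have /andP[H1 H2] := allP (allP (in_bools up inside_check) c cP) d dP.
  have cs : all (sat p) (take 2 (right_piece up) ++ [:: con_opp c; con_opp d]).
    by rewrite all_cat yP /= sc sd.
  have [far|near] := boolP (sat p (y_far up)).
    exfalso; apply: Bp; apply: (@sat_band _ up) => //.
    by apply: entails_allP H1 _; rewrite /= far.
  exfalso; apply: Kp; apply: sat_kite.
  by apply: entails_allP H2 _; rewrite /= sat_opp near.
have outside P : (forall up cs, cs \in [:: kite_sides; band true; band false] ->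
    infeasible (P up ++ cs)) -> in_pieces P p -> Sigma p ->
    (@Sigma R `\` @kite R `\` @B R) p.
  move=> H [up pP] Sp.
  have no cs : cs \in [:: kite_sides; band true; band false] -> ~ all (sat p) cs.
    by move=> /(H up)/(@infeasibleP R p); rewrite all_cat pP => /negP.
  split; first split=> //.
    by move=> /kite_sat; apply: no; rewrite !inE eqxx.
  by move=> /band_sat[_ [[] /no]]; apply; rewrite !inE eqxx ?orbT.
move=> [rp|lp].
- have [h1 h2 _ _] := (right_setP p).1 rp.
  apply: outside rp _; last by rewrite /Sigma /= h1 h2.
  by move=> up cs cK; have /andP[] := allP (in_bools up outside_check) cs cK.
- have [h1 h2 _ _] := (left_setP p).1 lp.
  apply: outside lp _; last by rewrite /Sigma /= h1 h2.
  by move=> up cs cK; have /andP[] := allP (in_bools up outside_check) cs cK.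
Qed.

(** A connected set that meets one of two disjoint open sets covering it stays in
it. *)
Lemma connected_component_separated (S1 S2 O1 O2 : set (R * R)) x :
  open O1 -> open O2 -> O1 `&` O2 = set0 -> S1 `<=` O1 -> S2 `<=` O2 -> S1 x ->
  connected_component (S1 `|` S2) x `<=` S1.
Proof.
move=> oO1 oO2 O12 SO1 SO2 S1x y [C [Cx CS Cc] Cy].
have CE : C `&` O1 = C.
  apply: Cc; first by exists x; split=> //; exact: SO1.
    by exists O1.
  exists (~` O2); first exact: open_closedC.
  apply/seteqP; split=> z [Cz]; split=> //.
    by move=> O2z; have : (O1 `&` O2) z by []; rewrite O12.
  by case: (CS z Cz) => [/SO1//|/SO2].
have : C y by []; rewrite -CE => -[_ O1y].
case: (CS y Cy) => // /SO2 O2y.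
by have : (O1 `&` O2) y by []; rewrite O12.
Qed.

Lemma segment_component (A : set (R * R)) (f : R -> R * R) (s t : R) : s <= t ->
  continuous f -> (forall r, s <= r <= t -> A (f r)) ->
  connected_component A (f s) (f t).
Proof.
move=> st cf fA; apply: (@connected_component_max _ A (f @` `[s, t])).
- by exists s => //=; rewrite in_itv /= lexx.
- by move=> _ [r + <-]; rewrite /= in_itv => /fA.
- apply: connected_continuous_connected; first exact: segment_connected.
  exact: continuous_subspaceT.
- by exists t => //=; rewrite in_itv /= lexx st.
Qed.

Lemma segment_component_any (A : set (R * R)) (f : R -> R * R) (s t : R) :
  continuous f -> (forall r, Num.min s t <= r <= Num.max s t -> A (f r)) ->
  connected_component A (f s) (f t).
Proof.
move=> cf; case: (leP s t) => st fA; first exact: segment_component.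
by apply: connected_component_sym; apply: segment_component => //; exact: ltW.
Qed.

Lemma horizontal_continuous (y : R) : continuous (fun x : R => (x, y)).
Proof.
move=> x; apply: (@cvg_pair _ _ _ _ (nbhs x) (nbhs y) _ _ _ id (fun=> y)).
  exact: cvg_id.
exact: cvg_cst.
Qed.

Lemma vertical_continuous (x : R) : continuous (fun y : R => (x, y)).
Proof.
move=> y; apply: (@cvg_pair _ _ _ _ (nbhs x) (nbhs y) _ _ _ (fun=> x) id).
  exact: cvg_cst.
exact: cvg_id.
Qed.

Lemma open_regions :
  open [set p : R * R | `|p.2| - 1 < p.1 /\ a * (1 - `|p.2|) < p.1] /\
  open [set p : R * R | p.1 < `|p.2| - 1 /\ p.1 < a * (1 - `|p.2|)].
Proof.
have cabs : continuous (fun p : R * R => `|p.2|).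
  move=> p; apply: continuous_comp; first exact: cvg_snd.
  exact: norm_continuous.
have c1 : continuous (fun p : R * R => p.1 - (`|p.2| - 1)).
  move=> p; apply: cvgB; first exact: cvg_fst.
  by apply: cvgB; [exact: cabs|exact: cvg_cst].
have c2 : continuous (fun p : R * R => p.1 - a * (1 - `|p.2|)).
  move=> p; apply: cvgB; first exact: cvg_fst.
  apply: cvgM; first exact: cvg_cst.
  by apply: cvgB; [exact: cvg_cst|exact: cabs].
have ogt (g : R * R -> R) : continuous g -> open [set p | 0 < g p].
  by move=> cg; apply: (@open_comp _ _ g [set x | 0 < x]) => //; exact: open_gt.
have olt (g : R * R -> R) : continuous g -> open [set p | g p < 0].
  by move=> cg; apply: (@open_comp _ _ g [set x | x < 0]) => //; exact: open_lt.
split.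
  rewrite (_ : [set _ | _] = [set p | 0 < p.1 - (`|p.2| - 1)] `&`
    [set p | 0 < p.1 - a * (1 - `|p.2|)]); first by apply: openI; exact: ogt.
  by apply/seteqP; split=> p /=; rewrite !subr_gt0.
rewrite (_ : [set _ | _] = [set p | p.1 - (`|p.2| - 1) < 0] `&`
  [set p | p.1 - a * (1 - `|p.2|) < 0]); first by apply: openI; exact: olt.
by apply/seteqP; split=> p /=; rewrite !subr_lt0.
Qed.

(** A point is joined to (1, 0) by a path that first goes to the right, beyond the
kite and B, then vertically, then back. *)
Lemma Sigma_rightE : @Sigma_right R = right_set.
Proof.
have /andP[a0 a1] := a_bounds; have [Uo Vo] := open_regions.
rewrite /Sigma_right complement_regions; apply/seteqP; split.
  apply: connected_component_separated Uo Vo _ _ _ _.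
  - by apply/seteqP; split=> // p /= [[h1 h2] [h3 h4]]; lra.
  - by move=> p /right_setP[].
  - by move=> p /left_setP[].
  - by apply/right_setP; rewrite /= normr0; split; lra.
move=> [x y] /right_setP[/= y1 y2 x1 x2].
pose X := Num.max x 2.
have Xx : x <= X by rewrite le_max lexx.
have X2 : 2 <= X by rewrite le_max lexx orbT.
have yn : `|y| <= 2 by rewrite ler_norml; apply/andP; split; lra.
apply: (connected_component_trans (y := (X, 0))).
  apply: (segment_component_any (f := fun x => (x, 0))); first exact: horizontal_continuous.
  have X1 : 1 <= X := le_trans (ler1n R 2) X2.
  rewrite min_l // max_r // => r /andP[r1 r2]; left.
  by apply/right_setP; rewrite /= normr0; split; lra.
apply: (connected_component_trans (y := (X, y))).
  apply: (segment_component_any (f := fun y => (X, y))); first exact: vertical_continuous.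
  move=> r rP; have rn : -2 < r /\ r <= 2.
    by move: rP; case: (leP 0 y) => y0 /andP[r1 r2]; split; lra.
  have rn' : `|r| <= 2 by rewrite ler_norml; apply/andP; split; lra.
  have ar0 : 0 <= a * `|r| by rewrite mulr_ge0 // ltW.
  have ar2 : a * `|r| <= a * 2 by rewrite ler_wpM2l // ltW.
  have rn0 : 0 <= `|r| by [].
  by left; apply/right_setP; rewrite /=; split; lra.
apply: (segment_component_any (f := fun x => (x, y))); first exact: horizontal_continuous.
rewrite min_r // max_l // => r /andP[r1 r2].
by left; apply/right_setP; rewrite /=; split; lra.
Qed.

Lemma Sigma_leftE : @Sigma_left R = left_set.
Proof.
have /andP[a0 a1] := a_bounds; have [Uo Vo] := open_regions.
rewrite /Sigma_left complement_regions setUC; apply/seteqP; split.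
  apply: connected_component_separated Vo Uo _ _ _ _.
  - by apply/seteqP; split=> // p /= [[h1 h2] [h3 h4]]; lra.
  - by move=> p /left_setP[].
  - by move=> p /right_setP[].
  - by apply/left_setP; rewrite /= normr0; split; lra.
move=> [x y] /left_setP[/= y1 y2 x1 x2].
pose X := Num.min x (-2).
have Xx : X <= x by rewrite ge_min lexx.
have X2 : X <= -2 by rewrite ge_min lexx orbT.
have yn : `|y| <= 2 by rewrite ler_norml; apply/andP; split; lra.
apply: (connected_component_trans (y := (X, 0))).
  apply: (segment_component_any (f := fun x => (x, 0))); first exact: horizontal_continuous.
  rewrite min_r // max_l // => r /andP[r1 r2].
  by left; apply/left_setP; rewrite /= normr0; split; lra.
apply: (connected_component_trans (y := (X, y))).
  apply: (segment_component_any (f := fun y => (X, y))); first exact: vertical_continuous.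
  move=> r rP; have rn : -2 < r /\ r <= 2.
    by move: rP; case: (leP 0 y) => y0 /andP[r1 r2]; split; lra.
  have rn' : `|r| <= 2 by rewrite ler_norml; apply/andP; split; lra.
  have ar0 : 0 <= a * `|r| by rewrite mulr_ge0 // ltW.
  have ar2 : a * `|r| <= a * 2 by rewrite ler_wpM2l // ltW.
  have rn0 : 0 <= `|r| by [].
  by left; apply/left_setP; rewrite /=; split; lra.
apply: (segment_component_any (f := fun x => (x, y))); first exact: horizontal_continuous.
rewrite min_l // max_r // => r /andP[r1 r2].
by left; apply/left_setP; rewrite /=; split; lra.
Qed.

Theorem Psi_on_course p q (t : torus R 3) : Psi p q -> on_course 0 0 p t ->
  Theta q = t.
Proof.
move=> [[KBp ->]|+|+] pt.
- have twice cs ms : entails_all cs (mids 0 (zcst 0, zcst 0) ms) -> size ms = 5%N ->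
      zpeq (move_sum 0 ms) (zcst 0, zcst 0) -> all (sat p) cs -> Theta p = t.
    move=> H s5 z0 sp.
    have := fixed_on_course (or_introl erefl) H s5 z0 sp pt.
    exact: (fixed_on_course (or_intror erefl) H s5 z0 sp).
  case: KBp => [/kite_sat kp|/band_sat[_ [[] bp]]].
  + by apply: twice kite_fixed_check _ _ kp; vm_compute.
  + by apply: twice upper_band_fixed_check _ _ bp; vm_compute.
  + by apply: twice lower_band_fixed_check _ _ bp; vm_compute.
- rewrite Sigma_leftE => pq.
  apply: (first_return_on_course left_half_check right_half_check _ _ _ pq pt) => //.
  by move=> z lz rz; exact: right_left_disjoint rz lz.
- rewrite Sigma_rightE => pq.
  apply: (first_return_on_course right_half_check left_half_check _ _ _ pq pt) => //.
  exact: right_left_disjoint.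
Qed.

End Regions.

(** * The embedding *)

Section Embedding.
Variable R : realType.
Implicit Types p q : R * R.

Lemma nbhs_pairP p (A : set (R * R)) : nbhs p A <->
  exists2 e : R, 0 < e & forall q, `|q.1 - p.1| < e -> `|q.2 - p.2| < e -> A q.
Proof.
split.
  move=> /nbhs_ballP[e /= e0 He]; exists e => // q q1 q2; apply: He.
  by split; rewrite /ball /= distrC.
move=> [e e0 He]; apply/nbhs_ballP; exists e => //= q [q1 q2].
by apply: He; rewrite distrC.
Qed.

Lemma entryB n (u v : 'rV[R]_n) j : (u - v) 0 j = u 0 j - v 0 j.
Proof. by rewrite !mxE. Qed.

Lemma Theta_liftB p q : Theta_lift p - Theta_lift q =
  \row_j [:: (p.1 - q.1) / phi R; ((p.1 - q.1) - (p.2 - q.2)) / 2; p.2 - q.2]`_j.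
Proof. by apply: rowP3; rewrite !mxE /=; ring. Qed.

(** Infinite descent: reducing modulo 2, both m and n have to be even. *)
Lemma golden_equation (m n : int) : m * m = n * m + n * n -> n = 0.
Proof.
have [N] := ubnP `|n|%N; elim: N m n => // N IHN m n nN E.
have [m' [r [r01 mE]]] : exists m' r : int, (r = 0 \/ r = 1) /\ m = 2 * m' + r.
  by exists (divz m 2), (modz m 2); lia.
have [n' [s [s01 nE]]] : exists n' s : int, (s = 0 \/ s = 1) /\ n = 2 * n' + s.
  by exists (divz n 2), (modz n 2); lia.
have rs : r = 0 /\ s = 0.
  by move: E; rewrite mE nE; case: r01 => ->; case: s01 => ->; lia.
have [r0 s0] := rs; rewrite r0 s0 !addr0 in mE nE.
have [n0|n0] := eqVneq n 0; first by [].
have n'0 : n' = 0.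
  by apply: (IHN m'); [lia|move: E; rewrite mE nE; lia].
by rewrite nE n'0 mulr0.
Qed.

Lemma phi_irrational (m n : int) : m%:~R = n%:~R * phi R -> n = 0.
Proof.
move=> E; apply: (@golden_equation m).
apply: (@intr_inj R); rewrite !rmorphD !rmorphM /= E.
have := phi_sqr R; set x := phi R => x2.
by transitivity (n%:~R ^+ 2 * x ^+ 2 : R); [ring|rewrite x2; ring].
Qed.

(** Two points with the same image differ by (2 a phi, 2 c) with integers a and c,
and 2 a phi is an integer too. *)
Lemma Theta_inj : set_inj (@Sigma R) (@Theta R).
Proof.
move=> p q /set_mem/andP[p1 p2] /set_mem/andP[q1 q2] /torus_piE/even_latticeP.
rewrite Theta_liftB => H.
have := H 0; have := H 1; have := H 2; rewrite !mxE /=.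
move=> [c cE] [b bE] [a aE].
have xE : p.1 - q.1 = (4 * b + 2 * c)%:~R.
  by rewrite rmorphD !rmorphM /=; lra.
have xE' : p.1 - q.1 = (2 * a)%:~R * phi R.
  by rewrite rmorphM /= -aE divfK // phi_neq0.
have a0 : 2 * a = 0 by apply: (@phi_irrational (4 * b + 2 * c)); rewrite -xE -xE'.
have x0 : p.1 - q.1 = 0 by rewrite xE' a0 mul0r.
have bc : 4 * b + 2 * c = 0 by apply: (@intr_inj R); rewrite -xE x0.
have cE' : c%:~R = - 2 * b%:~R :> R.
  move/(congr1 (fun z : int => z%:~R : R)): bc.
  by rewrite rmorphD !rmorphM /= => ?; lra.
have b0 : b = 0 by apply: (@int_near0 R); lra.
have c0 : c = 0 by move: bc; rewrite b0; lia.
have y0 : p.2 - q.2 = 0 by rewrite cE c0 mulr0.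
by apply: injective_projections; apply/eqP; rewrite -subr_eq0 ?x0 ?y0.
Qed.

Lemma Theta_lift_near p q (e : R) (j : 'I_3) : `|q.1 - p.1| < e -> `|q.2 - p.2| < e ->
  `|Theta_lift q 0 j - Theta_lift p 0 j| < e.
Proof.
have -> : Theta_lift q 0 j - Theta_lift p 0 j = (Theta_lift q - Theta_lift p) 0 j.
  by rewrite entryB.
rewrite Theta_liftB mxE !ltr_norml => /andP[x1 x2] /andP[y1 y2].
have /andP[f1 f2] := phi_bounds R.
case: j => -[|[|[|//]]] h /=; apply/andP; split; rewrite ?phi_inv; nra.
Qed.

Lemma Theta_lift_continuous : continuous (@Theta_lift R).
Proof.
move=> p A /rV_nbhsP[e e0 He]; apply/nbhs_pairP; exists e => // q q1 q2.
by apply: He => j; exact: Theta_lift_near.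
Qed.

(** Two points of the square of side 1 around p whose images are close in the torus
have close images in R^3: these differ by a vector of (2Z)^3 with entries of modulus
less than 2, hence by zero. *)
Lemma Theta_embedding : injective_embedding (@Sigma R) (@Theta R).
Proof.
split; first exact: Theta_inj.
  apply: continuous_subspaceT => p.
  apply: (@continuous_comp _ _ _ (@Theta_lift R)); first exact: Theta_lift_continuous.
  exact: torus_pi_continuous.
move=> p _; exists [set q | `|q.1 - p.1| < 1 / 2 /\ `|q.2 - p.2| < 1 / 2].
  by apply/nbhs_pairP; exists (1 / 2) => //; lra.
move=> q [_ [qp1 qp2]] W /nbhs_pairP[e e0 He].
pose d := Num.min (e / 2) (1 / 2).
have d0 : 0 < d by rewrite lt_min !divr_gt0.
have de : d <= e / 2 by rewrite ge_min lexx.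
have d1 : d <= 1 / 2 by rewrite ge_min lexx orbT.
pose box : set 'rV[R]_3 := [set u | forall j, `|u 0 j - Theta_lift q 0 j| < d].
exists ((\pi_(torus R 3) : 'rV[R]_3 -> torus R 3) @` box°).
  apply: open_nbhs_nbhs; split; first exact/torus_pi_open/open_interior.
  by exists (Theta_lift q) => //; apply/rV_nbhsP; exists d.
move=> z [[_ [zp1 zp2]] [u /interior_subset ub /torus_piE/even_latticeP uz]].
have near j : `|Theta_lift z 0 j - Theta_lift q 0 j| < 1.
  apply: Theta_lift_near.
    have := ler_normB (z.1 - p.1) (q.1 - p.1).
    by rewrite opprB addrA subrK; lra.
  have := ler_normB (z.2 - p.2) (q.2 - p.2).
  by rewrite opprB addrA subrK; lra.
have uzE j : u 0 j = Theta_lift z 0 j.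
  have := uz j; rewrite entryB => -[m mE].
  have := near j; have := ub j; rewrite !ltr_norml => /andP[a1 a2] /andP[b1 b2].
  have m0 : m = 0 by apply: (@int_near0 R); lra.
  by apply/eqP; rewrite -subr_eq0 mE m0 mulr0.
have zq j : `|(Theta_lift z - Theta_lift q) 0 j| < d.
  by rewrite entryB; have := ub j; rewrite uzE.
have := zq 0; have := zq 2; rewrite Theta_liftB !mxE /= => y x.
apply: He; last by lra.
have /andP[f1 f2] := phi_bounds R.
rewrite -[z.1 - q.1](divfK (phi_neq0 R)) normrM (gtr0_norm (phi_gt0 R)); nra.
Qed.

End Embedding.

Theorem theorem5p1 (R : realType) :
  exists Psihat : polytope_exchange R 3,
    [/\ fibered_golden Psihat,
        injective_embedding (@Sigma R) (@Theta R) &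
        forall p q : R * R, Psi p q -> exchange_domain Psihat (Theta p) ->
          Psihat (Theta p) = Theta q].
Proof.
have [E [fE EE]] := fibered_exchange R.
exists E; split=> //; first exact: Theta_embedding.
move=> p q pq /EE[k [kE ->]]; apply/esym.
apply: Psi_on_course pq _.
have := @flows_itinerary R 8 0 (Theta_lift p) k; rewrite /on_course.
by apply.
Qed.
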